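(* Let $k\geq 1$ be an integer and let $M\subset \mathbb{R}^n$ be a proper $m$-dimensional (real-)analytic submanifold. Assume there exists a smooth family $\Gamma_x$, $x\in M$, of class-$k$ curves in $\mathbb{R}^n$ such that, for all $x\in M$, $\Gamma_x$ and $M$ have a contact of order $k(m+1)$ at $x$. Then $\Gamma_x\subset M$ for all $x\in M$.
   Context: Submanifolds are embedded and without boundary; a submanifold $M\subset\mathbb{R}^n$ is proper if the inclusion $M\to\mathbb{R}^n$ is a proper map, i.e. $M$ is a closed subset of $\mathbb{R}^n$. Class-$k$ curve: a curve $\Gamma\subset\mathbb{R}^n$ is of class $k$ if it can be parametrized by a map $\mathbb{R}\to\mathbb{R}^n$ whose coordinates are polynomial functions of degree at most $k$ (so $\Gamma$ is the image of this map). Smooth family: $\Gamma_x$, $x\in M$, is a smooth family of class-$k$ curves (with $x\in\Gamma_x$) if for every $p\in M$ there are an open neighbourhood $W$ of $p$ in $M$ and smooth maps $v_1,\ldots,v_k:W\to\mathbb{R}^n$ such that, for every $x\in W$, the map $\mathbb{R}\to\mathbb{R}^n$, $t\mapsto x+t\,v_1(x)+\cdots+t^k\,v_k(x)$, is a parametrization of $\Gamma_x$. Order of contact: two smooth curves $\gamma_1,\gamma_2:\mathbb{R}\to\mathbb{R}^n$ have a contact of order $j\in\mathbb{N}\cup\{0\}$ at $t_0$ if $\gamma_1^{(i)}(t_0)=\gamma_2^{(i)}(t_0)$ for all $i\in\{0,1,\ldots,j\}$. $\Gamma_x$ and $M$ have a contact of order $j$ at $x\in\Gamma_x\cap M$ if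 for every smooth curve $\gamma_1:\mathbb{R}\to\mathbb{R}^n$ with image in $\Gamma_x$ and $\gamma_1(0)=x$ there exists a smooth curve $\gamma_2:\mathbb{R}\to M$ such that $\gamma_1$ and $\gamma_2$ have a contact of order $j$ at $0$. *)

(* Defs.v *)
From HB Require Import structures.
From mathcomp Require Import all_boot all_order all_algebra finmap.
From mathcomp Require Import all_classical all_reals all_analysis.
From mathcomp Require Import summability.

Set Implicit Arguments.
Unset Strict Implicit.
Unset Printing Implicit Defensive.

Import Order.TTheory GRing.Theory Num.Theory.
Import numFieldNormedType.Exports.

Local Open Scope classical_set_scope.
Local Open Scope ring_scope.

Section Defs.
Context {R : realType}.

(* Iterated partial derivatives; the head of the list is differentiated last. *)
Fixpoint iter_partial n p (s : seq 'I_n) (f : 'rV[R]_n -> 'rV[R]_p)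
    : 'rV[R]_n -> 'rV[R]_p :=
  if s is i :: s' then
    fun x => 'D_(delta_mx 0 i : 'rV[R]_n) (iter_partial s' f) x
  else f.

Definition smooth_on n p (U : set 'rV[R]_n) (f : 'rV[R]_n -> 'rV[R]_p) : Prop :=
  forall (s : seq 'I_n) (x : 'rV[R]_n), U x ->
    {for x, continuous (iter_partial s f)} /\
    forall i : 'I_n,
      derivable (iter_partial s f) x (delta_mx 0 i : 'rV[R]_n).

(* Smoothness of a map defined on an arbitrary subset A: local extendability to
   smooth maps on open sets of the ambient space. When A is open in an embedded
   submanifold this is smoothness of a map between manifolds. *)
Definition smooth_map n p (A : set 'rV[R]_n) (f : 'rV[R]_n -> 'rV[R]_p) : Prop :=
  forall x, A x -> exists (U : set 'rV[R]_n) (g : 'rV[R]_n -> 'rV[R]_p),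
    [/\ open U, U x, smooth_on U g & forall y, (U `&` A) y -> f y = g y].

Definition smooth_curve n (g : R -> 'rV[R]_n) : Prop :=
  forall (i : nat) (t : R), derivable (derive1n i g) t 1.

Definition monomial n (a : {ffun 'I_n -> nat}) (x : 'rV[R]_n) : R :=
  \prod_(i < n) x 0 i ^+ a i.

(* Convergence along the filter of finite sets of multi-indices is
   unconditional, hence absolute, convergence of the power series. *)
Definition analytic_at n (f : 'rV[R]_n -> R) (p : 'rV[R]_n) : Prop :=
  exists c : {ffun 'I_n -> nat} -> R,
    \forall x \near p,
      partial_sum (fun a => c a * monomial a (x - p)) @ totally --> f x.

Definition analytic_on n p (U : set 'rV[R]_n) (f : 'rV[R]_n -> 'rV[R]_p) : Prop :=
  forall x, U x -> forall j : 'I_p, analytic_at (fun y => f y 0 j) x.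

Definition analytic_diffeo n (U V : set 'rV[R]_n) (phi : 'rV[R]_n -> 'rV[R]_n)
    : Prop :=
  exists psi : 'rV[R]_n -> 'rV[R]_n,
    [/\ analytic_on U phi, analytic_on V psi,
        forall x, U x -> V (phi x) /\ psi (phi x) = x &
        forall y, V y -> U (psi y) /\ phi (psi y) = y].

(* Around each point of M, some analytic diffeomorphism between open sets of
   R^n straightens M to R^m x {0}. *)
Definition analytic_submanifold n (m : nat) (M : set 'rV[R]_n) : Prop :=
  (m <= n)%N /\
  forall p, M p -> exists (U V : set 'rV[R]_n) (phi : 'rV[R]_n -> 'rV[R]_n),
    [/\ open U, U p, open V, analytic_diffeo U V phi &
        forall x, U x -> (M x <-> forall i : 'I_n, (m <= i)%N -> phi x 0 i = 0)].

Definition class_curve n (k : nat) (C : set 'rV[R]_n) : Prop :=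
  exists P : 'I_n -> {poly R},
    (forall i, size (P i) <= k.+1)%N /\
    C = range (fun t : R => \row_i (P i).[t]).

(* v i stands for v_(i+1). An open subset W of M is written M `&` O with O open
   in R^n. *)
Definition smooth_family n (k : nat) (M : set 'rV[R]_n)
    (Gamma : 'rV[R]_n -> set 'rV[R]_n) : Prop :=
  (forall x, M x -> class_curve k (Gamma x) /\ Gamma x x) /\
  forall p, M p ->
    exists (O : set 'rV[R]_n) (v : 'I_k -> 'rV[R]_n -> 'rV[R]_n),
      [/\ open O, O p, forall i, smooth_map (M `&` O) (v i) &
          forall x, (M `&` O) x ->
            Gamma x = range (fun t : R => x + \sum_(i < k) t ^+ i.+1 *: v i x)].

Definition curve_contact n (j : nat) (g1 g2 : R -> 'rV[R]_n) (t0 : R) : Prop :=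
  forall i, (i <= j)%N -> derive1n i g1 t0 = derive1n i g2 t0.

(* A smooth curve in M is a smooth curve in R^n with image in M, which agrees
   with smoothness into M because M is embedded. *)
Definition contact n (j : nat) (C M : set 'rV[R]_n) (x : 'rV[R]_n) : Prop :=
  forall g1 : R -> 'rV[R]_n,
    smooth_curve g1 -> range g1 `<=` C -> g1 0 = x ->
    exists g2 : R -> 'rV[R]_n,
      [/\ smooth_curve g2, range g2 `<=` M & curve_contact j g1 g2 0].

End Defs.

(* Main.v *)
From HB Require Import structures.
From mathcomp Require Import zify ring lra.
From mathcomp Require Import all_boot all_order all_algebra perm finmap.
From mathcomp Require Import all_classical all_reals all_analysis.
From mathcomp Require Import summability.
Require Import Defs.

(** Near a point of [M], parametrize the curves of the family by
    Phi(x, t) = x + t v_1(x) + ... + t^k v_k(x) and let f be one of the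
    equations of [M] given by a chart.  The heart of the matter is a bound on
    degrees.  The derivatives of Phi in the m directions of [M] are polynomials
    of degree at most k in t, and its derivative in t has degree at most k - 1,
    so the (m + 1)-minors formed by these m + 1 vectors are polynomials of
    degree less than k (m + 1).  Contact of order k (m + 1) means that
    f(Phi(x, t)) = O(t^(k (m + 1) + 1)) for every x in [M]; differentiating
    along [M] and in t, the m + 1 vectors are tangent to the m-dimensional [M]
    up to O(t^(k (m + 1))), which makes the minors divisible by
    t^(k (m + 1)).  Hence the minors vanish identically.

    As the m derivatives along [M] are independent at t = 0, the derivative in
    t is then a combination of them.  Suppose that f(Phi(x, t)) = O(t^N) for
    all x in [M].  The derivatives along [M] are also O(t^N), so the derivative
    in t is O(t^N), and integration gives f(Phi(x, t)) = O(t^(N + 1)).  By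
    induction f(Phi(x, t)) is flat at t = 0; being analytic it vanishes for
    small t, and the curve starts inside [M].  It stays there because the
    parameters near which it is in [M] form a clopen set.

    The degree argument is the statement [contact_gain] on matrices of
    polynomials, and the induction step is [family_gain].  Orders in t
    and derivatives in x are combined by replacing f(Phi(x, t)) with the
    polynomial [taylor] in t, built by iterating the formal chain rule:
    [taylor_bigO] says that it approximates f(Phi(x, t)) to the expected order,
    and [taylor_variation] computes its derivative in x.  Both rest on the fact
    that partial derivatives of analytic functions are analytic and commute
    ([analytic_partial], [analytic_partialC]), proved on power series.  The end
    of the proof is [analytic_flat], a Cauchy majorant argument, and
    [poly_curve_continuation]. *)

Set Implicit Arguments.
Unset Strict Implicit.
Unset Printing Implicit Defensive.

Import Order.TTheory GRing.Theory Num.Theory.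
Import numFieldNormedType.Exports.

Local Open Scope classical_set_scope.
Local Open Scope ring_scope.

(** * Unconditionally convergent real series *)
#[local] Existing Instance totally_filter.

Section Unconditional.
Context {R : realType} {I : choiceType}.
Implicit Types (u v : I -> R) (A B : {fset I}).

Lemma partial_sumE u A : partial_sum u A = \sum_(a <- A) u a.
Proof. by rewrite /partial_sum big_seq_fsetE. Qed.

Lemma totallyP (P : set {fset I}) :
  totally P <-> exists A, forall B, (A `<=` B)%fset -> P B.
Proof.
split=> [[A _ AP]|[A AP]]; first by exists A => B /AP.
by exists A.
Qed.

Lemma unordered_sum_cvgP u (l : R) : partial_sum u @ totally --> l <->
  forall e, 0 < e -> exists A, forall B, (A `<=` B)%fset ->
    `|\sum_(a <- B) u a - l| <= e.
Proof.
split=> [/cvgrPdist_le ul e /ul /totallyP[A AP]|H].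
  by exists A => B /AP; rewrite /= partial_sumE distrC.
apply/cvgrPdist_le => e /H[A AP]; apply/totallyP; exists A => B /AP.
by rewrite /= partial_sumE distrC.
Qed.

Lemma unordered_sum_dist_le u (l s e : R) A0 : partial_sum u @ totally --> l ->
  (forall B, (A0 `<=` B)%fset -> `|\sum_(a <- B) u a - s| <= e) ->
  `|l - s| <= e.
Proof.
move=> /unordered_sum_cvgP ul H; apply/ler_addgt0Pr => d d0.
have [A AP] := ul _ d0.
have /AP h1 : (A `<=` A `|` A0)%fset by rewrite fsubsetUl.
have /H h2 : (A0 `<=` A `|` A0)%fset by rewrite fsubsetUr.
move: h1 h2; set S := \sum_(a <- _) _ => h1 h2.
have -> : l - s = (S - s) - (S - l) by ring.
by apply: le_trans (ler_normB _ _) _; rewrite lerD.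
Qed.

Lemma sum_fsetU u A B : [disjoint A & B]%fset ->
  \sum_(a <- (A `|` B)%fset) u a = \sum_(a <- A) u a + \sum_(a <- B) u a.
Proof.
move=> /fdisjointP AB; rewrite (big_fsetID _ (mem A)) /=; congr (_ + _).
  by apply: eq_fbigl => x; rewrite !inE /=; case: (x \in A); rewrite ?andbF.
apply: eq_fbigl => x; rewrite !inE /=; have := AB x.
by case: (x \in A) => /= [/(_ isT)/negbTE->|_]; rewrite ?andbT.
Qed.

Lemma unordered_sum_le u A B : (A `<=` B)%fset -> (forall a, 0 <= u a) ->
  \sum_(a <- A) u a <= \sum_(a <- B) u a.
Proof.
move=> AB u0; rewrite -(fsetID A B) sum_fsetU /=; last first.
  by apply/fdisjointP => x; rewrite !inE => /andP[xB xA]; rewrite xA.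
have -> : (B `&` A)%fset = A by apply/fsetIidPr.
by rewrite lerDl sumr_ge0.
Qed.

(** Unconditional convergence is absolute: beyond the finite set where the
    partial sums have stabilized up to 1, the terms of a fixed sign add up to
    at most 2, whichever finite set of them is taken. *)
Lemma unordered_sum_abs_bounded u (l : R) : partial_sum u @ totally --> l ->
  exists K, forall A, \sum_(a <- A) `|u a| <= K.
Proof.
move=> /unordered_sum_cvgP /(_ _ ltr01)[A0 AP].
have key (C : {fset I}) : [disjoint A0 & C]%fset -> `|\sum_(a <- C) u a| <= 2.
  move=> AC.
  have /AP h1 : (A0 `<=` A0 `|` C)%fset by rewrite fsubsetUl.
  have /AP h2 : (A0 `<=` A0)%fset by [].
  move: h1; rewrite sum_fsetU //= => h1.
  set S := \sum_(a <- C) _ in h1 *; set S0 := \sum_(a <- A0) _ in h1 h2.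
  have -> : S = (S0 + S - l) - (S0 - l) by ring.
  apply: le_trans (ler_normB _ _) _.
  by rewrite (_ : 2 = 1 + 1) // lerD.
exists (\sum_(a <- A0) `|u a| + (2 + 2)) => B.
pose Bp := [fset a in B `\` A0 | 0 <= u a]%fset.
pose Bn := [fset a in B `\` A0 | u a < 0]%fset.
apply: (@le_trans _ _ (\sum_(a <- (A0 `|` (Bp `|` Bn))%fset) `|u a|)).
  apply: unordered_sum_le => //; apply/fsubsetP => x xB; rewrite !inE xB andbT.
  by case: (x \in A0) => //=; case: ltP.
have dA (P : pred I) : [disjoint A0 & [fset a in B `\` A0 | P a]]%fset.
  by apply/fdisjointP => x xA0; rewrite !inE xA0.
rewrite sum_fsetU /=; last by rewrite fdisjointXU !dA.
rewrite lerD2l sum_fsetU /=; last first.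
  by apply/fdisjointP => x; rewrite !inE => /andP[-> ux]; rewrite ltNge ux.
apply: lerD.
- apply: le_trans (key Bp (dA _)); apply: le_trans (ler_norm _).
  rewrite big_seq [leRHS]big_seq; apply: ler_sum => a.
  by rewrite !inE => /andP[_ ua]; rewrite ger0_norm.
- apply: le_trans (key Bn (dA _)); rewrite -normrN; apply: le_trans (ler_norm _).
  rewrite -sumrN big_seq [leRHS]big_seq; apply: ler_sum => a.
  by rewrite !inE => /andP[_ ua]; rewrite ltr0_norm.
Qed.

Lemma unordered_sum_ge0_cvg u K : (forall a, 0 <= u a) ->
  (forall A, \sum_(a <- A) u a <= K) -> exists l : R, partial_sum u @ totally --> l.
Proof.
move=> u0 uK; pose E := [set \sum_(a <- A) u a | A in [set: {fset I}]].
have Es : has_sup E.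
  split; first by exists (\sum_(a <- fset0) u a); exists fset0.
  by exists K => _ [A _ <-].
exists (sup E); apply/unordered_sum_cvgP => e e0.
have [_ [A _ <-] Ae] := sup_adherent e0 Es.
exists A => B AB; have h := unordered_sum_le AB u0.
have hB : \sum_(a <- B) u a <= sup E by apply: ub_le_sup; [case: Es|exists B].
rewrite distrC ger0_norm ?subr_ge0 //.
by rewrite lerBlDl -lerBlDr; apply: le_trans (ltW Ae) _.
Qed.

(** Conversely, a series with bounded absolute sums is the difference of two
    series of nonnegative terms, each of which converges to a supremum. *)
Lemma unordered_sum_cvg u K : (forall A, \sum_(a <- A) `|u a| <= K) ->
  exists l : R, partial_sum u @ totally --> l.
Proof.
move=> uK.
have [l1 h1] := unordered_sum_ge0_cvg (fun a => normr_ge0 (u a)) uK.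
have u2 a : 0 <= `|u a| + u a by rewrite -lerBlDr sub0r -normrN ler_norm.
have [l2 h2] : exists l : R, partial_sum (fun a => `|u a| + u a) @ totally --> l.
  apply: (@unordered_sum_ge0_cvg _ (K + K)) => // A; rewrite big_split /=;
    apply: lerD => //.
  by apply: le_trans (uK A); apply: ler_sum => a _; exact: ler_norm.
exists (l2 - l1).
have -> : partial_sum u = (partial_sum (fun a => `|u a| +
  u a)) \- partial_sum (fun a => `|u a|).
  apply/funext => A /=; rewrite !partial_sumE -sumrB; apply: eq_bigr => a _.
  by rewrite addrAC subrr add0r.
exact: cvgB.
Qed.

End Unconditional.

(** * Monomials *)
Section MultiIndex.
Context {R : realType} {n : nat}.
Local Notation N := {ffun 'I_n -> nat}.
Implicit Types (a b : N) (x h : 'rV[R]_n).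

Definition mdeg a : nat := (\sum_i a i)%N.
Definition mincr (i : 'I_n) a : N := [ffun l => (a l + (l == i))%N].
Definition mdecr (i : 'I_n) a : N := [ffun l => (a l - (l == i))%N].

Lemma mincrK i : cancel (mincr i) (mdecr i).
Proof. by move=> a; apply/ffunP => l; rewrite !ffunE addnK. Qed.

Lemma mdecrK i a : (0 < a i)%N -> mincr i (mdecr i a) = a.
Proof.
move=> ai; apply/ffunP => l; rewrite !ffunE; case: eqP => [->|_].
  by rewrite subnK.
by rewrite subn0 addn0.
Qed.

Lemma mdeg_incr i a : mdeg (mincr i a) = (mdeg a).+1.
Proof.
rewrite /mdeg; under eq_bigr do rewrite ffunE.
rewrite big_split /= -[RHS]addn1; congr (_ + _)%N.
by rewrite (bigD1 i) //= eqxx big1 // => l /negbTE ->.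
Qed.

Lemma le_mdeg i a : (a i <= mdeg a)%N.
Proof. by rewrite /mdeg (bigD1 i) //= leq_addr. Qed.

Lemma coord_le x i : `|x 0 i| <= `|x|.
Proof.
rewrite [leRHS]/Num.Def.normr /= mx_normrE.
exact: (le_bigmax _ (fun ij : 'I_1 * 'I_n => `|x ij.1 ij.2|) (0, i)).
Qed.

Lemma norm_rV_le x (e : R) : 0 <= e -> (forall i, `|x 0 i| <= e) -> `|x| <= e.
Proof.
move=> e0 xe; rewrite [leLHS]/Num.Def.normr /= mx_normrE.
by apply: bigmax_le => // -[i j] _ /=; rewrite ord1.
Qed.

Lemma monomial_le a x (r : R) : `|x| <= r -> `|monomial a x| <= r ^+ mdeg a.
Proof.
move=> xr; rewrite /monomial /mdeg normr_prod -prodrXr.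
apply: ler_prod => i _; rewrite normr_ge0 /= normrX.
by apply: lerXn2r; rewrite ?nnegrE ?normr_ge0 ?(le_trans (coord_le x i)) //
  (le_trans _ xr).
Qed.

Definition cofactor_monomial (i : 'I_n) a x : R :=
  \prod_(l < n | l != i) x 0 l ^+ a l.

Lemma monomialE i a x : monomial a x = x 0 i ^+ a i * cofactor_monomial i a x.
Proof. by rewrite /monomial (bigD1 i). Qed.

Lemma cofactor_monomial_le i a x (r : R) : `|x| <= r ->
  `|cofactor_monomial i a x| * r ^+ a i <= r ^+ mdeg a.
Proof.
move=> xr; rewrite /cofactor_monomial normr_prod /mdeg.
rewrite [X in _ <= _ ^+ X](bigD1 i) //= exprD mulrC.
have r0 : 0 <= r by rewrite (le_trans _ xr).
apply: ler_wpM2l; first exact: exprn_ge0.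
rewrite -prodrXr; apply: ler_prod => l _; rewrite normr_ge0 /= normrX.
by apply: lerXn2r; rewrite ?nnegrE ?normr_ge0 ?(le_trans (coord_le x l)).
Qed.

Lemma cofactor_monomial_shift i a x t :
  cofactor_monomial i a (x + t *: delta_mx 0 i) = cofactor_monomial i a x.
Proof.
by apply: eq_bigr => l li; rewrite !mxE (negbTE li) andbF mulr0 addr0.
Qed.

Lemma cofactor_monomial_incr i a x :
  cofactor_monomial i (mincr i a) x = cofactor_monomial i a x.
Proof. by apply: eq_bigr => l /negbTE li; rewrite ffunE li addn0. Qed.

End MultiIndex.

(** The remainder is written with [4 ^+ n * r ^+ n] so that summing over the
    monomials of a series only costs a division of its radius by 4. *)
Lemma exprD_taylor1_le (R : realFieldType) (y t r : R) (n : nat) :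
  0 < r -> `|y| <= r -> `|y + t| <= r ->
  `|(y + t) ^+ n - y ^+ n - t * (n%:R * y ^+ n.-1)| <=
    (t ^+ 2 / r ^+ 2) * (4 ^+ n * r ^+ n).
Proof.
move=> r0 yr ytr.
have n4 m : m%:R ^+ 2 <= 4 ^+ m :> R.
  have -> : 4 ^+ m = (2 ^+ m) ^+ 2 :> R.
    by rewrite -exprM mulnC exprM; congr (_ ^+ _); ring.
  rewrite lerXn2r ?nnegrE ?exprn_ge0 // -natrX ler_nat; exact: ltnW (ltn_expl _ _).
suff : `|(y + t) ^+ n - y ^+ n - t * (n%:R * y ^+ n.-1)| <=
    (t ^+ 2 / r ^+ 2) * (n%:R ^+ 2 * r ^+ n).
  move=> /le_trans; apply; apply: ler_wpM2l;
    first by rewrite divr_ge0 ?exprn_even_ge0 // ltW ?exprn_gt0.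
  by apply: ler_wpM2r => //; rewrite exprn_ge0 // ltW.
elim: n => [|n IH]; first by
  rewrite !expr0 subrr mul0r mulr0 subr0 normr0 expr0n /= mul0r mulr0.
case: n IH => [|n] IH.
  have -> : (y + t) ^+ 1 - y ^+ 1 - t * (1%:R * y ^+ 1.-1) = 0 by rewrite /=; ring.
  by rewrite normr0; apply: mulr_ge0;
    rewrite ?divr_ge0 ?sqr_ge0 // expr1n mul1r expr1 ltW.
have -> : (y + t) ^+ n.+2 - y ^+ n.+2 - t * (n.+2%:R * y ^+ n.+2.-1) =
   (y + t) * ((y + t) ^+ n.+1 - y ^+ n.+1 - t * (n.+1%:R * y ^+ n.+1.-1)) +
   t ^+ 2 * (n.+1%:R * y ^+ n).
  by rewrite /= -[n.+2%:R]natr1 !exprS; ring.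
apply: le_trans (ler_normD _ _) _.
have h1 := ler_pM (normr_ge0 _) (normr_ge0 _) ytr IH.
have h2 : `|t ^+ 2 * (n.+1%:R * y ^+ n)| <= t ^+ 2 * (n.+1%:R * r ^+ n).
  rewrite normrM (ger0_norm (sqr_ge0 t)) normrM normr_nat normrX.
  rewrite ler_wpM2l ?sqr_ge0 // ler_wpM2l // lerXn2r ?nnegrE //.
  by rewrite ltW.
rewrite normrM; apply: le_trans (lerD h1 h2) _.
have r20 : r != 0 by rewrite gt_eqF.
have -> : t ^+ 2 / r ^+ 2 * (n.+2%:R ^+ 2 * r ^+ n.+2) =
  t ^+ 2 * (n.+2%:R ^+ 2 * r ^+ n).
  by rewrite -[n.+2]addn2 exprD; field.
have -> : r * (t ^+ 2 / r ^+ 2 * (n.+1%:R ^+ 2 * r ^+ n.+1)) =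
  t ^+ 2 * (n.+1%:R ^+ 2 * r ^+ n).
  by rewrite [r ^+ n.+1]exprS; field.
rewrite -mulrDr ler_wpM2l ?exprn_even_ge0 // -mulrDl ler_wpM2r ?exprn_ge0 ?ltW //.
rewrite -[n.+2%:R]natr1; have : 0 <= n.+1%:R :> R by [].
by nra.
Qed.

(** * Termwise differentiation of power series *)
Section Expansion.
Context {R : realType} {n : nat}.
Local Notation N := {ffun 'I_n -> nat}.
Local Notation V := 'rV[R]_n.
Implicit Types (a b : N) (x h p : V) (f g : V -> R) (c : N -> R).

Definition partial (i : 'I_n) f : V -> R := fun x => 'D_(delta_mx 0 i : V) f x.

(** A quantitative form of absolute convergence on the polydisc of radius [r];
    all later estimates are made term by term against it. *)
Definition abs_bounded c (r K : R) : Prop :=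
  forall A : {fset N}, \sum_(a <- A) `|c a| * r ^+ mdeg a <= K.

Definition expansion f p c (r : R) : Prop :=
  forall h, `|h| <= r ->
    partial_sum (fun a => c a * monomial a h) @ totally --> f (p + h).

(** Convergence at the corner [const_mx (e / 2)] of a polydisc bounds the
    absolute sums on the whole polydisc. *)
Lemma analytic_expansion f p : analytic_at f p ->
  exists c r K, [/\ 0 < r, abs_bounded c r K & expansion f p c r].
Proof.
move=> [c /nbhs_ballP[e /= e0 pe]].
have ex : expansion f p c (e / 2).
  move=> h he; have := pe (p + h).
  rewrite [p + h - p]addrC addKr; apply.
  rewrite -ball_normE /= opprD addNKr normrN.
  by rewrite (le_lt_trans he) // ltr_pdivrMr // ltr_pMr // ltr1n.
have r0 : 0 < e / 2 by rewrite divr_gt0.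
pose h0 : V := const_mx (e / 2).
have /ex/unordered_sum_abs_bounded[K HK] : `|h0| <= e / 2.
  by apply: norm_rV_le => [|i]; rewrite ?mxE ?gtr0_norm // ltW.
exists c, (e / 2), K; split => // A; apply: le_trans (HK A).
rewrite le_eqVlt; apply/orP; left; apply/eqP; apply: eq_bigr => a _.
rewrite normrM; congr (_ * _); rewrite ger0_norm.
  by rewrite /monomial /mdeg -prodrXr; apply: eq_bigr => i _; rewrite mxE.
by apply: prodr_ge0 => i _; rewrite mxE exprn_ge0 // ltW.
Qed.

Lemma expansion_analytic f p c (r : R) : 0 < r -> expansion f p c r ->
  analytic_at f p.
Proof.
move=> r0 ex; exists c; apply/nbhs_ballP; exists r => // x.
rewrite -ball_normE /= => xr; have := ex (x - p).
by rewrite [p + _]addrC subrK; apply; rewrite distrC ltW.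
Qed.

Lemma abs_bounded_ge0 c r K : abs_bounded c r K -> 0 <= K.
Proof. by move=> /(_ fset0); rewrite big_seq_fset0. Qed.

Lemma abs_bounded_sum c (r K : R) (h : V) (A : {fset N}) :
  abs_bounded c r K -> `|h| <= r -> \sum_(a <- A) `|c a * monomial a h| <= K.
Proof.
move=> cK hr; apply: le_trans (cK A); apply: ler_sum => a _.
by rewrite normrM ler_wpM2l // monomial_le.
Qed.

(** The coefficients of the formal partial derivative. *)
Definition coef_partial (i : 'I_n) c : N -> R :=
  fun b => (b i).+1%:R * c (mincr i b).

Lemma coef_partialC i j c : coef_partial i (coef_partial j c) =
  coef_partial j (coef_partial i c).
Proof.
apply/funext => b; rewrite /coef_partial !mulrA !ffunE.
have -> : mincr i (mincr j b) = mincr j (mincr i b).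
  by apply/ffunP => l; rewrite !ffunE addnAC.
congr (_ * _); case: (eqVneq i j) => [->//|ij].
by rewrite !addn0 mulrC.
Qed.

Lemma natr_le_exp4 (m : nat) : m%:R <= 4 ^+ m :> R.
Proof. by rewrite -natrX ler_nat ltnW // ltn_expl. Qed.

Lemma sum_mincr i (F : N -> R) (B : {fset N}) :
  \sum_(a <- (mincr i @` B)%fset) F a = \sum_(b <- B) F (mincr i b).
Proof.
by rewrite big_imfset //= => x y _ _; exact: (can_inj (mincrK i)).
Qed.

Lemma abs_bounded_partial i c (r K : R) : 0 < r -> abs_bounded c r K ->
  abs_bounded (coef_partial i c) (r / 4) (K / (r / 4)).
Proof.
move=> r0 cK B; have r4 : 0 < r / 4 by rewrite divr_gt0.
rewrite ler_pdivlMr // mulr_suml.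
pose F a := (a i)%:R * `|c a| * (r / 4) ^+ mdeg a.
have -> : \sum_(b <- B) `|coef_partial i c b| * (r / 4) ^+ mdeg b * (r / 4) =
    \sum_(a <- (mincr i @` B)%fset) F a.
  rewrite sum_mincr.
  apply: eq_bigr => b _; rewrite /F /coef_partial normrM normr_nat mdeg_incr.
  by rewrite ffunE eqxx addn1 exprSr !mulrA.
apply: le_trans (cK (mincr i @` B)%fset); apply: ler_sum => a _.
rewrite /F [_%:R * _]mulrC -mulrA ler_wpM2l //.
rewrite exprMn -[leRHS]mulr1 mulrCA ler_wpM2l ?exprn_ge0 ?(ltW r0) //.
rewrite exprVn ler_pdivrMr ?exprn_gt0 // mul1r.
apply: le_trans (natr_le_exp4 _) _; rewrite ler_weXn2l ?ler1n //; exact: le_mdeg.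
Qed.

(** The function [g] is the sum of the formal derivative.  Its difference with
    the difference quotient of [f] is bounded by a multiple of the increment,
    uniformly over finite partial sums, which gives the derivative without any
    exchange of limits. *)
Lemma expansion_derivative i f p c (r K : R) : 0 < r -> abs_bounded c r K ->
  expansion f p c r ->
  exists2 g, expansion g p (coef_partial i c) (r / 4) &
    forall h, `|h| < r / 4 -> is_derive (p + h) (delta_mx 0 i : V) f (g (p + h)).
Proof.
move=> r0 cK fc; have r4 : 0 < r / 4 by rewrite divr_gt0.
have dK := abs_bounded_partial i r0 cK.
have lim_ex x : exists l : R, `|x - p| <= r / 4 ->
    partial_sum (fun a => coef_partial i c a * monomial a (x - p)) @ totally --> l.
  case: (lerP `|x - p| (r / 4)) => [xp|_]; last by exists 0.
  by have [l] := unordered_sum_cvg (fun A => abs_bounded_sum A dK xp); exists l.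
pose g x := sval (cid (lim_ex x)).
have gE h : `|h| <= r / 4 ->
    partial_sum (fun a => coef_partial i c a * monomial a h) @ totally --> g (p + h).
  rewrite /g => hr; case: cid => l /=.
  by rewrite [p + h - p]addrC addKr; apply.
exists g => // h hr; set e := delta_mx 0 i : V.
have rr : r / 4 <= r by rewrite ler_pdivrMr // ler_peMr ?ler1n // ltW.
pose C := K / (r / 4) ^+ 2.
have C0 : 0 <= C by rewrite divr_ge0 ?sqr_ge0 // (abs_bounded_ge0 cK).
have key t : `|h + t *: e| <= r / 4 ->
    `|f (p + (h + t *: e)) - f (p + h) - t * g (p + h)| <= C * t ^+ 2.
  move=> ht; apply/ler_addgt0Pr => d d0.
  pose d' := d / (2 + `|t|).
  have d'0 : 0 < d' by rewrite divr_gt0 // ltr_wpDr.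
  have /unordered_sum_cvgP/(_ _ d'0)[A1 hA1] := fc _ (le_trans ht rr).
  have /unordered_sum_cvgP/(_ _ d'0)[A2 hA2] := fc _ (le_trans (ltW hr) rr).
  have /unordered_sum_cvgP/(_ _ d'0)[B0 hB0] := gE _ (ltW hr).
  (* B and A are large enough for the three limits, and differ, up to the shift
     of indices, by monomials whose i-th partial derivative is 0. *)
  pose B := (B0 `|` mdecr i @` (A1 `|` A2))%fset.
  pose A := ((A1 `|` A2) `|` mincr i @` B)%fset.
  have /hA1 e1 : (A1 `<=` A)%fset by rewrite /A -fsetUA fsubsetUl.
  have /hA2 e2 : (A2 `<=` A)%fset by rewrite /A fsubsetU // fsubsetUr.
  have /hB0 e3 : (B0 `<=` B)%fset by rewrite /B fsubsetUl.
  have GE : \sum_(b <- B) coef_partial i c b * monomial b h =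
      \sum_(a <- A) c a * ((a i)%:R * h 0 i ^+ (a i).-1 * cofactor_monomial i a h).
    transitivity (\sum_(a <- (mincr i @` B)%fset)
       c a * ((a i)%:R * h 0 i ^+ (a i).-1 * cofactor_monomial i a h)).
      rewrite sum_mincr.
      apply: eq_bigr => b _; rewrite /coef_partial cofactor_monomial_incr ffunE eqxx.
      by rewrite addn1 /= (monomialE i); ring.
    apply: big_fset_incl; first by rewrite /A fsubsetUr.
    move=> a; rewrite in_fsetU => /orP[|->//] aA aB.
    case: (posnP (a i)) => [->|ai]; first by rewrite !mul0r mulr0.
    case/negP: aB; apply/imfsetP; exists (mdecr i a) => /=; last by rewrite mdecrK.
    by rewrite in_fsetU; apply/orP; right; apply/imfsetP; exists a.
  move: e1 e2 e3; rewrite GE.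
  set S1 := \sum_(a <- A) _; set S2 := \sum_(a <- A) _; set S3 := \sum_(a <- A) _.
  move=> e1 e2 e3.
  have bnd : `|S1 - S2 - t * S3| <= C * t ^+ 2.
    rewrite /S1 /S2 /S3 mulr_sumr -!sumrB.
    apply: le_trans (ler_norm_sum _ _ _) _.
    have -> : C * t ^+ 2 = t ^+ 2 / (r / 4) ^+ 2 * K by rewrite /C; ring.
    apply: (@le_trans _ _ (\sum_(a <- A) t ^+ 2 / (r / 4) ^+ 2 * (`|c a| * r ^+ mdeg a))).
      apply: ler_sum => a _; rewrite !(monomialE i) cofactor_monomial_shift.
      have -> : (h + t *: e) 0 i = h 0 i + t by rewrite !mxE !eqxx mulr1.
      set m := cofactor_monomial i a h.
      have -> : c a * ((h 0 i + t) ^+ a i * m) - c a * (h 0 i ^+ a i * m) -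
        t * (c a * ((a i)%:R * h 0 i ^+ (a i).-1 * m)) =
        c a * (((h 0 i + t) ^+ a i - h 0 i ^+ a i - t * ((a i)%:R * h 0 i ^+ (a i).-1)) * m).
        by ring.
      rewrite normrM [leRHS]mulrCA ler_wpM2l // normrM.
      have yr : `|h 0 i| <= r / 4 by rewrite (le_trans (coord_le _ _)) // ltW.
      have ytr : `|h 0 i + t| <= r / 4.
        by apply: le_trans ht; apply: le_trans (coord_le _ i); rewrite !mxE !eqxx mulr1.
      have := exprD_taylor1_le (a i) r4 yr ytr.
      move=> /(ler_wpM2r (normr_ge0 m)) /le_trans; apply.
      rewrite -[leLHS]mulrA ler_wpM2l ?divr_ge0 ?sqr_ge0 //.
      apply: (@le_trans _ _ (4 ^+ mdeg a * (r / 4) ^+ mdeg a)).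
        rewrite -[leLHS]mulrA [_ ^+ a i * `|m|]mulrC; apply: ler_pM;
          rewrite ?exprn_ge0 ?mulr_ge0 ?exprn_ge0 ?normr_ge0 // ?(ltW r4) //.
          by rewrite ler_weXn2l ?ler1n ?le_mdeg.
        by apply: cofactor_monomial_le; rewrite ltW.
      by rewrite -exprMn mulrC divfK.
    rewrite -mulr_sumr ler_wpM2l ?divr_ge0 ?sqr_ge0 //.
  have -> : f (p + (h + t *: e)) - f (p + h) - t * g (p + h) =
     (S1 - S2 - t * S3) - (S1 - f (p + (h + t *: e))) + (S2 - f (p + h)) +
       t * (S3 - g (p + h)).
    by ring.
  have dE : d = d' + d' + `|t| * d'.
    by rewrite /d'; field; rewrite gt_eqF // ltr_wpDr.
  rewrite dE [leRHS]addrA [C * _ + (_ + _)]addrA.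
  apply: le_trans (ler_normD _ _) _; apply: lerD; last by rewrite normrM ler_wpM2l.
  apply: le_trans (ler_normD _ _) _; apply: lerD => //.
  by apply: le_trans (ler_normB _ _) _; apply: lerD.
have D : (fun t => t^-1 *: ((f \o shift (p + h)) (t *: e) - f (p + h))) @ 0^' -->
  g (p + h).
  apply/cvgrPdist_le => d d0.
  have [s s0 hs] : exists2 s : R, 0 < s & forall t, `|t| < s -> `|h + t *: e| <= r / 4.
    exists (r / 4 - `|h|); first by rewrite subr_gt0.
    move=> t ts; apply: le_trans (ler_normD _ _) _; rewrite -lerBrDl normrZ.
    apply: le_trans (ltW ts); rewrite ler_piMr //.
    by apply: norm_rV_le => // j; rewrite mxE /=; case: (_ == _);
      rewrite ?normr1 ?normr0.
  near=> t.
  have t0 : t != 0 by near: t; exact: nbhs_dnbhs_neq.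
  have ts : `|t| < s by near: t; exact: dnbhs0_lt.
  have := key _ (hs _ ts).
  have -> : g (p + h) - t^-1 *: ((f \o shift (p + h)) (t *: e) - f (p + h)) =
     - (t^-1 * (f (p + (h + t *: e)) - f (p + h) - t * g (p + h))).
    rewrite /= [t *: e + _]addrC addrA /GRing.scale /=; field.
    exact: t0.
  rewrite normrN normrM normfV => kt.
  rewrite mulrC ler_pdivrMr ?normr_gt0 //; apply: le_trans kt _.
  rewrite -[t ^+ 2]real_normK ?num_real // expr2 mulrA ler_wpM2r //.
  have : `|t| <= d / (C + 1) by near: t; apply: dnbhs0_le; rewrite divr_gt0 // ltr_wpDl.
  rewrite ler_pdivlMr ?ltr_wpDl //; apply: le_trans.
  by rewrite mulrC ler_wpM2l // lerDl.
split; first by apply/cvg_ex; exists (g (p + h)).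
exact: cvg_lim D.
Unshelve. all: by end_near.
Qed.

End Expansion.

(** * Differentiation along curves *)
Section Chain.
Context {R : realType}.

Lemma near0_lt (e : R) : 0 < e -> \forall u \near (0 : R), `|u| < e.
Proof.
by move=> e0; apply/nbhs_ballP; exists e => // u; rewrite /ball /= sub0r normrN.
Qed.

Lemma is_derive1P (g : R -> R) (t d : R) : is_derive t 1 g d <->
  forall e, 0 < e -> \forall u \near 0, `|g (t + u) - g t - u * d| <= e * `|u|.
Proof.
split=> [[gd <-] e e0|H].
  have /cvgrPdist_le /(_ e e0) : (fun h => h^-1 *: ((g \o shift t) (h *: 1) - g t)) @ 0^' --> 'D_1 g t.
    exact: gd.
  rewrite !near_withinE; apply: filterS => u H.
  have [->|u0] := eqVneq u 0; first by rewrite addr0 subrr mul0r subr0 normr0 mulr0.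
  have := H u0; rewrite /= [u *: 1]mulr1 [u + t]addrC => h.
  rewrite -ler_pdivrMr ?normr_gt0 // -normf_div -normrN; apply: le_trans h.
  by rewrite le_eqVlt; apply/orP; left; apply/eqP; congr (`|_|);
    rewrite /GRing.scale /=; field.
have D : (fun h => h^-1 *: ((g \o shift t) (h *: 1) - g t)) @ 0^' --> d.
  apply/cvgrPdist_le => e /H; rewrite near_withinE; apply: filterS => u Hu u0.
  rewrite /= [u *: 1]mulr1 [u + t]addrC.
  move: Hu; rewrite -ler_pdivrMr ?normr_gt0 // -normf_div -normrN; apply: le_trans.
  by rewrite le_eqVlt; apply/orP; left; apply/eqP; congr (`|_|);
    rewrite /GRing.scale /=; field.
split; first by apply/cvg_ex; exists d.
exact: cvg_lim D.
Qed.

Lemma mean_value (g dg : R -> R) (s : R) :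
  (forall u : R, `|u| <= `|s| -> is_derive u 1 g (dg u)) ->
  exists2 c, `|c| <= `|s| & g s - g 0 = dg c * s.
Proof.
move=> gd.
have gc (a b : R) : (forall x, x \in `[a, b] -> `|x| <= `|s|) ->
    {within `[a, b], continuous g}.
  move=> H; apply: derivable_within_continuous => x xab.
  by have [] := gd x (H x xab).
case: (ltgtP s 0) => s0.
- have h x : x \in `[s, 0] -> `|x| <= `|s|.
    by rewrite in_itv /= => /andP[sx x0]; rewrite (ltr0_norm s0) ler0_norm // lerN2.
  have [c cs E] := MVT s0 (fun x xs => gd x (h x (subset_itv_oo_cc xs))) (gc _ _ h).
  exists c; first exact/h/subset_itv_oo_cc.
  by rewrite -opprB E sub0r mulrN opprK.
- have h x : x \in `[0, s] -> `|x| <= `|s|.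
    by rewrite in_itv /= => /andP[x0 sx]; rewrite (gtr0_norm s0) ger0_norm.
  have [c cs E] := MVT s0 (fun x xs => gd x (h x (subset_itv_oo_cc xs))) (gc _ _ h).
  exists c; first exact/h/subset_itv_oo_cc.
  by rewrite E subr0.
- by exists 0; rewrite ?normr0 // s0 subrr mulr0.
Qed.

Context {n : nat}.
Local Notation V := 'rV[R]_n.

Lemma is_derive_line (f : V -> R) (y : V) i (u : R) :
  derivable f (y + u *: delta_mx 0 i) (delta_mx 0 i) ->
  is_derive u 1 (fun s : R => f (y + s *: delta_mx 0 i))
    (partial i f (y + u *: delta_mx 0 i)).
Proof.
move=> /derivableP [fd fe].
have E : (fun h : R => h^-1 *: (((fun s : R => f (y +
  s *: delta_mx 0 i)) \o shift u) (h *: 1) -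
    f (y + u *: delta_mx 0 i))) =
   (fun h => h^-1 *: ((f \o shift (y +
     u *: delta_mx 0 i)) (h *: delta_mx 0 i) - f (y + u *: delta_mx 0 i))).
  apply/funext => h /=; congr (_ *: (f _ - _)).
  by rewrite [h *: 1]mulr1 scalerDl addrCA.
by split; rewrite /derivable /derive E.
Qed.

(** The increment along a vector is split into increments along its
    coordinates; the mean value theorem turns each of them into a partial
    derivative at a nearby point. *)
Lemma C1_frechet (f : V -> R) (x : V) :
  (forall i, \forall y \near x, derivable f y (delta_mx 0 i : V)) ->
  (forall i, {for x, continuous (partial i f)}) ->
  forall e, 0 < e -> \forall h \near (0 : V),
    `|f (x + h) - f x - \sum_i partial i f x * h 0 i| <= e * `|h|.
Proof.
move=> fd fc e e0.
pose d := e / n.+1%:R.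
have d0 : 0 < d by rewrite divr_gt0.
have [s s0 hs] : exists2 s : R, 0 < s & forall y, `|y| < s -> forall i,
   derivable f (x + y) (delta_mx 0 i : V) /\ `|partial i f (x +
     y) - partial i f x| <= d.
  have H : \forall y \near x, forall i, derivable f y (delta_mx 0 i : V) /\
     `|partial i f y - partial i f x| <= d.
    apply: (filter_forall (F := nbhs x)) => i; apply: filterI; first exact: fd.
    by have /cvgrPdist_le /(_ d d0) := fc i; apply: filterS => y; rewrite distrC.
  have /nbhs_ballP[s /= s0 sH] := H; exists s => // y ys; apply: sH.
  by rewrite -ball_normE /= opprD addNKr normrN.
apply/nbhs_ballP; exists s => // h; rewrite -ball_normE /= sub0r normrN => hs'.
pose tr (k : nat) : V := \row_i (if (i < k)%N then h 0 i else 0).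
have trn k : `|tr k| <= `|h|.
  apply: norm_rV_le => // i; rewrite mxE; case: ifP => _; last by rewrite normr0.
  exact: coord_le.
have trS (i : 'I_n) : tr i.+1 = tr i + h 0 i *: delta_mx 0 i.
  apply/rowP => j; rewrite !mxE eqxx /= ltnS leq_eqVlt -(inj_eq val_inj).
  by case: (ltngtP (val j) (val i)) => [||/val_inj->];
    rewrite ?mulr0 ?mulr1 ?addr0 ?add0r.
have -> : f (x + h) - f x = \sum_(i < n) (f (x + tr i.+1) - f (x + tr i)).
  rewrite -(big_mkord xpredT (fun i => f (x + tr i.+1) - f (x + tr i))).
  rewrite telescope_sumr //.
  have -> : tr n = h by apply/rowP => i; rewrite mxE ltn_ord.
  by have -> : tr 0 = 0 by [apply/rowP => i; rewrite !mxE]; rewrite addr0.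
rewrite -sumrB; apply: le_trans (ler_norm_sum _ _ _) _.
apply: (@le_trans _ _ (\sum_(i < n) d * `|h|)); last first.
  rewrite sumr_const card_ord -[_ *+ n]mulr_natl /d mulrA ler_wpM2r //.
  by rewrite mulrCA ler_piMr ?(ltW e0) // ler_pdivrMr ?ltr0n // mul1r ler_nat.
apply: ler_sum => i _.
have near_h u : `|u| <= `|h 0 i| -> `|tr i + u *: delta_mx 0 i| <= `|h|.
  move=> uh; apply: norm_rV_le => // j; rewrite !mxE eqxx /=.
  case: (ltngtP (val j) (val i)) => [ji|ij|/val_inj->].
  - by rewrite -(inj_eq val_inj) ltn_eqF // mulr0 addr0 coord_le.
  - by rewrite -(inj_eq val_inj) gtn_eqF // mulr0 addr0 normr0.
  - by rewrite eqxx mulr1 add0r (le_trans uh) // coord_le.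
have [|c ch E] := @mean_value (fun s => f (x + tr i + s *: delta_mx 0 i))
    (fun s => partial i f (x + tr i + s *: delta_mx 0 i)) (h 0 i).
  move=> u uh; apply: is_derive_line.
  have [] := hs (tr i + u *: delta_mx 0 i) _ i; last by rewrite addrA.
  exact: le_lt_trans (near_h u uh) hs'.
move: E; rewrite scale0r addr0 -addrA -trS => ->.
rewrite -mulrBl normrM; apply: ler_pM => //; last exact: coord_le.
rewrite -addrA; have [] := hs (tr i + c *: delta_mx 0 i) _ i => //.
exact: le_lt_trans (near_h c ch) hs'.
Qed.

Lemma frechet_chain (f : V -> R) (c : 'I_n -> R) (g : R -> V) (t : R) (d : 'I_n -> R) :
  (forall e, 0 < e -> \forall h \near (0 : V),
    `|f (g t + h) - f (g t) - \sum_i c i * h 0 i| <= e * `|h|) ->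
  (forall i, is_derive t 1 (fun s => g s 0 i) (d i)) ->
  is_derive t 1 (f \o g) (\sum_i c i * d i).
Proof.
move=> fx gd; apply/is_derive1P => e e0.
pose S := \sum_i `|c i|; pose D := \sum_i `|d i|.
have S0 : 0 <= S by exact: sumr_ge0.
have D0 : 0 <= D by exact: sumr_ge0.
pose e1 := e / 2 / (D + 1).
have e10 : 0 < e1 by rewrite !divr_gt0 // ltr_wpDl.
pose e2 := Num.min 1 (e / 2 / (S + 1)).
have e20 : 0 < e2 by rewrite lt_min ltr01 !divr_gt0 // ltr_wpDl.
have /nbhs_ballP[s /= s0 hs] := fx _ e10.
have H2 : \forall u \near (0 : R), forall i,
    `|g (t + u) 0 i - g t 0 i - u * d i| <= e2 * `|u|.
  by apply: (filter_forall (F := nbhs (0 : R))) => i; have /is_derive1P := gd i; apply.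
near=> u.
have Hu : forall i, `|g (t + u) 0 i - g t 0 i - u * d i| <= e2 * `|u| by near: u.
set h := g (t + u) - g t.
have hn : `|h| <= (D + 1) * `|u|.
  apply: norm_rV_le => [|i]; first by rewrite mulr_ge0 // addr_ge0.
  have -> : h 0 i = (g (t + u) 0 i - g t 0 i - u * d i) + d i * u.
    by rewrite /h !mxE; ring.
  apply: le_trans (ler_normD _ _) _; rewrite addrC mulrDl; apply: lerD.
    rewrite normrM ler_wpM2r // /D (bigD1 i) //= lerDl; exact: sumr_ge0.
  by apply: le_trans (Hu i) _; rewrite ler_wpM2r // ge_min lexx.
have /hs : ball 0 s h.
  rewrite -ball_normE /= sub0r normrN; apply: le_lt_trans hn _.
  rewrite mulrC -ltr_pdivlMr ?ltr_wpDl //; near: u; apply: near0_lt.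
  by rewrite divr_gt0 // ltr_wpDl.
rewrite [g t + h]addrC subrK => Hf.
have -> : (f \o g) (t + u) - (f \o g) t - u * (\sum_i c i * d i) =
   (f (g (t + u)) - f (g t) - \sum_i c i * h 0 i) + \sum_i c i * (h 0 i - u * d i).
  have -> : \sum_i c i * (h 0 i - u * d i) =
    \sum_i c i * h 0 i - u * (\sum_i c i * d i).
    by rewrite mulr_sumr -sumrB; apply: eq_bigr => i _; ring.
  by rewrite /=; ring.
apply: le_trans (ler_normD _ _) _.
have -> : e * `|u| = e1 * ((D + 1) * `|u|) + (e / 2) * `|u|.
  by rewrite /e1; field; rewrite gt_eqF // ltr_wpDl.
apply: lerD; first by apply: le_trans Hf _; rewrite ler_wpM2l // ltW.
apply: le_trans (ler_norm_sum _ _ _) _.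
apply: (@le_trans _ _ (\sum_i `|c i| * (e2 * `|u|))).
  apply: ler_sum => i _; rewrite normrM ler_wpM2l //.
  by have := Hu i; rewrite /h !mxE.
rewrite -mulr_suml -/S mulrA ler_wpM2r //.
apply: (@le_trans _ _ (S * (e / 2 / (S + 1)))).
  by rewrite ler_wpM2l // ge_min lexx orbT.
rewrite mulrA ler_pdivrMr ?ltr_wpDl // mulrC ler_wpM2l ?divr_ge0 ?(ltW e0) //.
by rewrite lerDl.
Unshelve. all: by end_near.
Qed.

Lemma C1_chain (f : V -> R) (g : R -> V) (t : R) (d : 'I_n -> R) :
  (forall i, \forall y \near g t, derivable f y (delta_mx 0 i : V)) ->
  (forall i, {for g t, continuous (partial i f)}) ->
  (forall i, is_derive t 1 (fun s => g s 0 i) (d i)) ->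
  is_derive t 1 (f \o g) (\sum_i partial i f (g t) * d i).
Proof. by move=> fd fc; apply: frechet_chain; exact: C1_frechet. Qed.

End Chain.

(** * Analytic functions *)
Section Analytic.
Context {R : realType} {n : nat}.
Local Notation N := {ffun 'I_n -> nat}.
Local Notation V := 'rV[R]_n.
Implicit Types (a b : N) (x h p : V) (f g : V -> R) (c : N -> R).

(** The terms of degree at least [d] gain the factor [(`|h| / r) ^+ d] over
    their values on the sphere of radius [r]. *)
Lemma expansion_tail f p c (r K : R) (A0 : {fset N}) (d : nat) h :
  0 < r -> abs_bounded c r K -> expansion f p c r ->
  (forall a, a \notin A0 -> (d <= mdeg a)%N) -> `|h| <= r ->
  `|f (p + h) - \sum_(a <- A0) c a * monomial a h| <= K * (`|h| / r) ^+ d.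
Proof.
move=> r0 cK fc hA hr; have hr0 : 0 <= `|h| / r by rewrite divr_ge0 // ltW.
apply: (@unordered_sum_dist_le _ _ _ _ _ _ A0 (fc _ hr)) => B AB.
have -> : B = (A0 `|` B `\` A0)%fset by rewrite fsetUDl fsetDv fsetD0;
  apply/esym/fsetUidPr.
rewrite sum_fsetU; last by apply/fdisjointP => a aA; rewrite inE aA.
rewrite addrAC subrr add0r; apply: le_trans (ler_norm_sum _ _ _) _.
apply: (@le_trans _ _ (\sum_(a <- (B `\` A0)%fset) `|c a| * r ^+ mdeg a * (`|h| / r) ^+ d)).
  rewrite big_seq [leRHS]big_seq; apply: ler_sum => a; rewrite inE => /andP[/hA da _].
  rewrite normrM -mulrA ler_wpM2l //; apply: le_trans (monomial_le a (lexx _)) _.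
  have -> : `|h| ^+ mdeg a = r ^+ mdeg a * (`|h| / r) ^+ mdeg a.
    by rewrite -exprMn mulrC divfK ?gt_eqF.
  rewrite ler_wpM2l ?exprn_ge0 ?(ltW r0) // ler_wiXn2l //.
  by rewrite ler_pdivrMr // mul1r.
rewrite -mulr_suml ler_wpM2r ?exprn_ge0 //; exact: cK.
Qed.

Lemma mdeg0P a : mdeg a = 0%N -> a = [ffun=> 0%N].
Proof.
move=> /eqP; rewrite /mdeg sum_nat_eq0 => /forallP H; apply/ffunP => i.
by rewrite ffunE; apply/eqP/(implyP (H i)).
Qed.

Lemma expansion_lipschitz f p c (r K : R) h :
  0 < r -> abs_bounded c r K -> expansion f p c r -> `|h| <= r ->
  `|f (p + h) - c [ffun=> 0%N]| <= K * (`|h| / r).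
Proof.
move=> r0 cK fc hr.
have := @expansion_tail f p c r K [fset [ffun=> 0%N]]%fset 1 h r0 cK fc _ hr.
rewrite big_seq_fset1 expr1 /monomial big1 ?mulr1; last by move=> i _; rewrite ffunE.
apply=> a; rewrite inE lt0n; apply: contra => /eqP/mdeg0P ->; exact: eqxx.
Qed.

Lemma expansion_center f p c (r K : R) :
  0 < r -> abs_bounded c r K -> expansion f p c r -> f p = c [ffun=> 0%N].
Proof.
move=> r0 cK fc; have := @expansion_lipschitz f p c r K 0 r0 cK fc.
rewrite addr0 normr0 mul0r mulr0 ltW // => /(_ isT).
by rewrite normr_le0 subr_eq0 => /eqP.
Qed.

Lemma analytic_continuous f p : analytic_at f p -> {for p, continuous f}.
Proof.
move=> /analytic_expansion[c [r [K [r0 cK fc]]]].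
apply/(@cvgrPdist_le _ _ _ (nbhs p) (nbhs_filter p)) => e e0.
rewrite (expansion_center r0 cK fc).
pose s := Num.min r (e * r / (K + 1)).
have K1 : 0 < K + 1 by rewrite ltr_wpDl // (abs_bounded_ge0 cK).
have s0 : 0 < s by rewrite lt_min r0 divr_gt0 // mulr_gt0.
apply/nbhs_ballP; exists s => // y.
rewrite -ball_normE /= distrC lt_min => /andP[yr ys].
have := expansion_lipschitz r0 cK fc (ltW yr).
rewrite [p + _]addrC subrK distrC => /le_trans; apply.
move: (ltW ys); rewrite ler_pdivlMr // => h.
rewrite mulrA ler_pdivrMr //; apply: le_trans h; rewrite mulrC ler_wpM2l //.
by rewrite lerDl.
Qed.

Lemma expansion_partial i f p c (r K : R) : 0 < r -> abs_bounded c r K ->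
  expansion f p c r ->
  (forall y, `|y - p| < r / 4 -> derivable f y (delta_mx 0 i : V)) /\
  expansion (partial i f) p (coef_partial i c) (r / 8).
Proof.
move=> r0 cK fc; have [g gc gd] := expansion_derivative i r0 cK fc.
have D y : `|y - p| < r / 4 -> is_derive y (delta_mx 0 i : V) f (g y).
  by move=> yr; have := gd _ yr; rewrite [p + _]addrC subrK.
have r84 : r / 8 < r / 4 by rewrite ltr_pM2l // ltf_pV2 ?posrE // ltr_nat.
split=> [y /D []//|h hr].
have -> : partial i f (p + h) = g (p + h).
  have [|_ <- //] := D (p + h).
  by rewrite [p + h]addrC addrK (le_lt_trans hr).
by apply: gc; rewrite (le_trans hr) // ltW.
Qed.

Lemma analytic_partial i f p : analytic_at f p -> analytic_at (partial i f) p.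
Proof.
move=> /analytic_expansion[c [r [K [r0 cK fc]]]].
have [_] := expansion_partial i r0 cK fc.
by apply: expansion_analytic; rewrite divr_gt0.
Qed.

Lemma analytic_derivable i f p : analytic_at f p ->
  \forall y \near p, derivable f y (delta_mx 0 i : V).
Proof.
move=> /analytic_expansion[c [r [K [r0 cK fc]]]].
have [fd _] := expansion_partial i r0 cK fc.
apply/nbhs_ballP; exists (r / 4) => /=; first by rewrite divr_gt0.
by move=> y; rewrite -ball_normE /= distrC => /fd.
Qed.

Lemma abs_bounded_shrink c (r s K : R) : 0 <= s <= r ->
  abs_bounded c r K -> abs_bounded c s K.
Proof.
move=> /andP[s0 sr] cK A; apply: le_trans (cK A); apply: ler_sum => a _.
by rewrite ler_wpM2l // lerXn2r ?nnegrE // (le_trans s0).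
Qed.

(** Both sides are the constant coefficient of the same twice differentiated
    power series. *)
Lemma analytic_partialC i j f p : analytic_at f p ->
  partial i (partial j f) p = partial j (partial i f) p.
Proof.
move=> /analytic_expansion[c [r [K [r0 cK fc]]]].
have bnd k : abs_bounded (coef_partial k c) (r / 8) (K / (r / 4)).
  apply: abs_bounded_shrink (abs_bounded_partial k r0 cK).
  by rewrite divr_ge0 ?ltW // ltr_pM2l // ltf_pV2 ?posrE // ltr_nat.
have r8 : 0 < r / 8 by rewrite divr_gt0.
have r84 : 0 < r / 8 / 8 by rewrite !divr_gt0.
have E k l : partial k (partial l f) p = coef_partial k (coef_partial l c) [ffun=> 0%N].
  have [_ fl] := expansion_partial l r0 cK fc.
  have [_ fkl] := expansion_partial k r8 (bnd l) fl.
  apply: (expansion_center r84 _ fkl).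
  apply: abs_bounded_shrink (abs_bounded_partial k r8 (bnd l)).
  by rewrite ltW // ltW // ltr_pM2l // ltf_pV2 ?posrE // ltr_nat.
by rewrite !E coef_partialC.
Qed.

Lemma analytic_chain f (g : R -> V) (t : R) (d : 'I_n -> R) :
  analytic_at f (g t) ->
  (forall i, is_derive t 1 (fun s => g s 0 i) (d i)) ->
  is_derive t 1 (f \o g) (\sum_i partial i f (g t) * d i).
Proof.
move=> fa; apply: C1_chain => i; first exact: analytic_derivable.
exact/analytic_continuous/analytic_partial.
Qed.

End Analytic.

(** * Orders of vanishing at 0 *)
Section BigO.
Context {R : realType}.
Implicit Types (p q : {poly R}) (g h : R -> R).

Definition bigO (d : nat) g : Prop :=
  exists C, \forall t \near (0 : R), `|g t| <= C * `|t| ^+ d.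

Lemma near0W (A : R -> Prop) : (forall t, A t) -> \forall t \near (0 : R), A t.
Proof. by move=> H; near=> t. Unshelve. all: by end_near. Qed.

Lemma bigO_le g h d : (\forall t \near (0 : R), `|g t| <= `|h t|) ->
  bigO d h -> bigO d g.
Proof.
move=> gh [C hC]; exists C; apply: filterS2 gh hC => t; exact: le_trans.
Qed.

Lemma bigO_near g h d : (\forall t \near (0 : R), g t = h t) -> bigO d h -> bigO d g.
Proof. by move=> gh; apply: bigO_le; apply: filterS gh => t ->. Qed.

Lemma bigOD d g h : bigO d g -> bigO d h -> bigO d (fun t => g t + h t).
Proof.
move=> [C gC] [D hD]; exists (C + D); apply: filterS2 gC hD => t gt ht.
by rewrite mulrDl (le_trans (ler_normD _ _)) // lerD.
Qed.

Lemma bigOM d e g h : bigO d g -> bigO e h -> bigO (d + e) (fun t => g t * h t).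
Proof.
move=> [C gC] [D hD]; exists (C * D); apply: filterS2 gC hD => t gt ht.
by rewrite exprD mulrACA normrM ler_pM.
Qed.

Lemma bigO0 d : bigO d (fun=> 0 : R).
Proof.
by exists 0; apply: near0W => t; rewrite normr0 mul0r.
Qed.

Lemma bigO_sum (I : Type) (s : seq I) d (F : I -> R -> R) :
  (forall i, bigO d (F i)) -> bigO d (fun t => \sum_(i <- s) F i t).
Proof.
move=> H; elim: s => [|a s IH].
  by apply: bigO_near (bigO0 d); apply: near0W => t; rewrite big_nil.
apply: bigO_near (bigOD (H a) IH).
by apply: near0W => t; rewrite big_cons.
Qed.

Lemma near0_le1 : \forall t \near (0 : R), `|t| <= 1.
Proof. by apply: filterS (near0_lt ltr01) => t; exact: ltW. Qed.

Lemma bigO_weaken d e g : (e <= d)%N -> bigO d g -> bigO e g.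
Proof.
move=> ed [C gC]; exists `|C|; apply: filterS2 gC near0_le1 => t gt t1.
apply: le_trans gt _; apply: (@le_trans _ _ (`|C| * `|t| ^+ d)).
  by rewrite ler_wpM2r ?exprn_ge0 // ler_norm.
by rewrite ler_wpM2l // ler_wiXn2l.
Qed.

Lemma bigO_derivable g : derivable g 0 1 -> bigO 0 g.
Proof.
move=> /derivable1_diffP/differentiable_continuous/cvgrPdist_le/(_ 1 ltr01) H.
exists (`|g 0| + 1); apply: filterS H => t h.
rewrite expr0 mulr1 -[g t](subrK (g 0)) addrC (le_trans (ler_normD _ _)) //.
by rewrite lerD // distrC.
Qed.

Lemma bigO_horner p : bigO 0 (horner p).
Proof. exact/bigO_derivable/derivable_horner. Qed.

(** By the mean value theorem, integration raises the order of vanishing. *)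
Lemma bigO_integrate d g (dg : R -> R) :
  (\forall t \near (0 : R), is_derive (t : R) 1 g (dg t)) -> g 0 = 0 -> bigO d dg ->
  bigO d.+1 g.
Proof.
move=> gd g0 [C hC]; exists `|C|.
have /nbhs_ballP[s /= s0 hs] : \forall t \near (0 : R), is_derive (t : R) 1 g (dg t) /\
   `|dg t| <= C * `|t| ^+ d by exact: filterI.
apply: filterS (near0_lt s0) => t ts.
have hs' u : `|u| <= `|t| -> is_derive (u : R) 1 g (dg u) /\ `|dg u| <= C * `|u| ^+ d.
  by move=> ut; apply: hs; rewrite /ball /= sub0r normrN (le_lt_trans ut).
have [u ut] := mean_value (fun u ut => (hs' u ut).1).
rewrite g0 subr0 => ->; rewrite normrM exprSr mulrA ler_wpM2r //.
apply: le_trans (hs' u ut).2 _; apply: (@le_trans _ _ (`|C| * `|u| ^+ d)).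
  by rewrite ler_wpM2r ?exprn_ge0 // ler_norm.
by rewrite ler_wpM2l // lerXn2r ?nnegrE.
Qed.

Lemma bigO_derivatives J (h : nat -> R -> R) :
  (forall i (t : R), is_derive t 1 (h i) (h i.+1 t)) ->
  (forall i, (i < J)%N -> h i 0 = 0) -> bigO J (h 0%N).
Proof.
elim: J h => [|J IH] h hd h0.
  by have [] := hd 0%N 0; move=> + _; exact: bigO_derivable.
apply: (bigO_integrate (dg := h 1%N)); [exact: near0W|exact: h0|].
by apply: (IH (fun i => h i.+1)) => // i iJ; exact: h0.
Qed.

Lemma poly_near0 p (e : R) : 0 < e ->
  exists2 s : R, 0 < s & forall t, `|t| < s -> `|p.[t] - p.[0]| < e.
Proof.
move=> e0; have /cvgrPdist_lt/(_ e e0)/nbhs_ballP[s s0 sH] := @continuous_horner R p 0.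
exists s => // t ts; rewrite distrC; apply: sH.
by rewrite /ball /= sub0r normrN.
Qed.

(** The bound is only required on some set accumulating at 0: a polynomial is
    governed by its lowest term, wherever 0 is approached from.  Analytic
    continuation starts from nothing more than accumulating zeros. *)
Lemma dvdXn_accum d p (C : R) :
  (forall e, 0 < e -> exists t, [/\ t != 0, `|t| < e & `|p.[t]| <= C * `|t| ^+ d]) ->
  'X^d %| p.
Proof.
elim: d C => [|d IH] C H; first by rewrite expr0 dvd1p.
have /dvdpP[q pE] : 'X^d %| p.
  apply: (IH `|C|) => e e0.
  have [|t [t0 + pt]] := H (Num.min 1 e); first by rewrite lt_min ltr01.
  rewrite lt_min => /andP[t1 te]; exists t; split => //; apply: le_trans pt _.
  apply: (@le_trans _ _ (`|C| * `|t| ^+ d.+1)).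
    by rewrite ler_wpM2r ?exprn_ge0 // ler_norm.
  by rewrite ler_wpM2l // exprS ler_piMl ?exprn_ge0 // ltW.
suff q0 : q.[0] = 0.
  have /dvdpP[q' qE] : 'X %| q by rewrite -['X]subr0 -polyC0 dvdp_XsubCl /root q0.
  by rewrite pE qE -mulrA -exprS dvdp_mull.
apply/eqP; rewrite -normr_eq0 eq_le normr_ge0 andbT; apply/ler_addgt0Pr => e e0.
have e20 : 0 < e / 2 by rewrite divr_gt0.
have [s s0 hs] := poly_near0 q e20.
have s'0 : 0 < Num.min s (e / 2 / (`|C| + 1)).
  by rewrite lt_min s0 divr_gt0 // ltr_wpDl.
have [t [t0 + pt]] := H _ s'0.
rewrite lt_min => /andP[ts tC].
have qt : `|q.[t]| <= e / 2.
  move: pt; rewrite pE hornerM hornerXn normrM normrX exprSr mulrA.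
  rewrite [C * _ * _]mulrAC ler_pM2r ?exprn_gt0 ?normr_gt0 // => /le_trans; apply.
  move: (ltW tC); rewrite ler_pdivlMr ?ltr_wpDl // => h; apply: le_trans h.
  by rewrite mulrC ler_wpM2l // (le_trans (ler_norm _)) // lerDl.
have -> : q.[0] = q.[t] - (q.[t] - q.[0]) by ring.
rewrite add0r; apply: le_trans (ler_normB _ _) _.
by rewrite [e]splitr lerD // ltW // hs.
Qed.

Lemma bigO_accum d g : bigO d g -> exists C, forall e, 0 < e ->
  exists t, [/\ t != 0, `|t| < e & `|g t| <= C * `|t| ^+ d].
Proof.
move=> [C /nbhs_ballP[s /= s0 hs]]; exists C => e e0.
pose t := Num.min s e / 2.
have m0 : 0 < Num.min s e by rewrite lt_min s0.
have t0 : 0 < t by rewrite divr_gt0.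
have tm : `|t| < Num.min s e.
  by rewrite gtr0_norm // ltr_pdivrMr // ltr_pMr // ltr1n.
exists t; split; first by rewrite gt_eqF.
  by apply: lt_le_trans tm _; rewrite ge_min lexx orbT.
apply: hs; rewrite /ball /= sub0r normrN; apply: lt_le_trans tm _.
by rewrite ge_min lexx.
Qed.

Lemma bigO_dvdXn d p : bigO d (horner p) -> 'X^d %| p.
Proof. by move=> /bigO_accum[C /dvdXn_accum]. Qed.

Lemma bigO_dvd d (p : {poly R}) : 'X^d %| p -> bigO d (horner p).
Proof.
move=> /dvdpP[q ->].
apply: (@bigO_near _ (fun t => q.[t] * t ^+ d)).
  by apply: near0W => t; rewrite hornerM hornerXn.
rewrite -[d in bigO d _]add0n; apply: bigOM; first exact: bigO_horner.
by exists 1; apply: near0W => t; rewrite mul1r normrX.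
Qed.

End BigO.

(** * Analytic functions that are flat along a polynomial curve *)
Section Flat.
Context {R : realType}.
Implicit Types (p q : {poly R}) (g : R -> R).

(** Coefficientwise majorization, Cauchy's device to bound a composite series by
    its value at a single positive point. *)
Definition majorized p q := forall i, `|p`_i| <= q`_i.

Lemma majorized_ge0 p q : majorized p q -> forall i, 0 <= q`_i.
Proof. by move=> pq i; exact: le_trans (pq i). Qed.

Lemma majorizedD p p' q q' : majorized p q -> majorized p' q' ->
  majorized (p + p') (q + q').
Proof.
by move=> pq pq' i; rewrite !coefD (le_trans (ler_normD _ _)) // lerD.
Qed.

Lemma majorizedM p p' q q' : majorized p q -> majorized p' q' ->
  majorized (p * p') (q * q').
Proof.
move=> pq pq' i; rewrite !coefM; apply: le_trans (ler_norm_sum _ _ _) _.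
by apply: ler_sum => j _; rewrite normrM ler_pM.
Qed.

Lemma majorized1 : majorized 1 1.
Proof. by move=> i; rewrite coef1; case: eqP; rewrite ?normr1 ?normr0. Qed.

Lemma majorizedX p q d : majorized p q -> majorized (p ^+ d) (q ^+ d).
Proof.
move=> pq; elim: d => [|d IH]; first exact: majorized1.
by rewrite !exprS; exact: majorizedM.
Qed.

Lemma majorizedZ (c : R) p q : majorized p q -> majorized (c *: p) (`|c| *: q).
Proof. by move=> pq i; rewrite !coefZ normrM ler_wpM2l. Qed.

Lemma majorized_sum (I : Type) (s : seq I) (F G : I -> {poly R}) :
  (forall i, majorized (F i) (G i)) ->
  majorized (\sum_(i <- s) F i) (\sum_(i <- s) G i).
Proof.
move=> FG; elim: s => [|a s IH]; last by rewrite !big_cons; exact: majorizedD.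
by rewrite !big_nil => i; rewrite coef0 normr0.
Qed.

Lemma majorized_horner d p q (t s : R) : majorized p q -> 'X^d %| p ->
  0 < s -> `|t| <= s -> `|p.[t]| <= (`|t| / s) ^+ d * q.[s].
Proof.
move=> pq /dvdpP[p' pE] s0 ts.
have ts1 : `|t| / s <= 1 by rewrite ler_pdivrMr // mul1r.
have ts0 : 0 <= `|t| / s by rewrite divr_ge0 // ltW.
rewrite (@horner_coef_wide _ (size p + size q) p) ?leq_addr //.
rewrite (@horner_coef_wide _ (size p + size q) q) ?leq_addl //.
apply: le_trans (ler_norm_sum _ _ _) _; rewrite mulr_sumr; apply: ler_sum => i _.
case: (ltnP i d) => [id|di].
  have -> : p`_i = 0 by move: (val i) id => j jd; rewrite pE coefMXn jd.
  rewrite mul0r normr0 mulr_ge0 ?exprn_ge0 //.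
  by rewrite mulr_ge0 ?(majorized_ge0 pq) // exprn_ge0 // ltW.
rewrite normrM normrX.
have -> : `|t| ^+ i = (`|t| / s) ^+ i * s ^+ i by rewrite -exprMn divfK // gt_eqF.
rewrite mulrCA; apply: ler_pM; rewrite ?mulr_ge0 ?exprn_ge0 ?(ltW s0) //.
  by rewrite ler_wiXn2l.
by rewrite ler_wpM2r ?exprn_ge0 ?(ltW s0).
Qed.

Context {n : nat}.
Local Notation N := {ffun 'I_n -> nat}.
Local Notation V := 'rV[R]_n.

Definition poly_curve (P : 'I_n -> {poly R}) (t : R) : V := \row_l (P l).[t].

Lemma mdeg_lt_fset (d : nat) : exists A : {fset N},
  forall a : N, a \notin A -> (d <= mdeg a)%N.
Proof.
pose F (g : {ffun 'I_n -> 'I_d}) : N := [ffun i => val (g i)].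
exists [fset a in [seq F g | g : {ffun 'I_n -> 'I_d}]]%fset => a.
apply: contraR; rewrite -ltnNge => ad; rewrite !inE /=; apply/mapP => /=.
have ai i : (a i < d)%N by rewrite (leq_ltn_trans (le_mdeg i a)).
exists [ffun i => Ordinal (ai i)]; first by rewrite mem_enum.
by apply/ffunP => i; rewrite !ffunE.
Qed.

(** Truncating the power series of [f] at degree [d] leaves a polynomial in [t]
    which, [f] being flat along the curve, has no term of degree below [d].
    Its value is then at most [(`|t| / s) ^+ d] times a majorant that does not
    depend on [d], and so is the truncation error; let [d] tend to infinity. *)
Lemma analytic_flat (f : V -> R) (P : 'I_n -> {poly R}) :
  analytic_at f (poly_curve P 0) ->
  (forall d, bigO d (fun t => f (poly_curve P t))) ->
  \forall t \near (0 : R), f (poly_curve P t) = 0.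
Proof.
move=> /analytic_expansion[c [r [K [r0 cK fc]]]] flat.
pose Q l := P l - (P l).[0]%:P.
pose aQ l := \poly_(i < size (Q l)) `|(Q l)`_i|.
pose H := \sum_l aQ l.
have aQE l i : (aQ l)`_i = `|(Q l)`_i|.
  by rewrite coef_poly; case: ltnP => // h; rewrite nth_default ?normr0.
have QaQ l : majorized (Q l) (aQ l) by move=> i; rewrite aQE.
have QH l : majorized (Q l) H.
  move=> i; rewrite /H coef_sum (bigD1 l) //= aQE lerDl; apply: sumr_ge0 => j _.
  by rewrite aQE.
have QX l : 'X^1 %| Q l.
  by rewrite expr1 -['X]subr0 -polyC0 dvdp_XsubCl /root /Q hornerD hornerN hornerC subrr.
have H0 : H.[0] = 0.
  rewrite /H horner_sum big1 // => l _; rewrite horner_coef0 aQE.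
  by rewrite -horner_coef0 /Q hornerD hornerN hornerC subrr normr0.
have [s' s'0 hs'] := poly_near0 H r0.
pose s := s' / 2.
have s0 : 0 < s by rewrite divr_gt0.
have Hs : H.[s] <= r.
  have : `|s| < s' by rewrite gtr0_norm // ltr_pdivrMr // ltr_pMr // ltr1n.
  by move=> /hs'; rewrite H0 subr0 => /ltW; apply: le_trans; exact: ler_norm.
pose hh t : V := \row_l (Q l).[t].
have hhE t : poly_curve P t = poly_curve P 0 + hh t.
  by apply/rowP => l; rewrite !mxE /Q hornerD hornerN hornerC addrC subrK.
have hhn t : `|t| <= s -> `|hh t| / r <= `|t| / s.
  move=> ts; rewrite ler_pdivrMr //; apply: norm_rV_le => [|l].
    by rewrite !mulr_ge0 // ?invr_ge0 ltW.
  rewrite mxE; apply: le_trans (majorized_horner (QH l) (QX l) s0 ts) _.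
  by rewrite expr1 ler_wpM2l // divr_ge0 // ltW.
have hhr t : `|t| <= s -> `|hh t| <= r.
  move=> ts; have := hhn t ts; rewrite ler_pdivrMr // => /le_trans; apply.
  by rewrite ler_piMl ?ler_pdivrMr ?mul1r // ltW.
have K0 : 0 <= K by exact: abs_bounded_ge0 cK.
have bnd d t : `|t| <= s -> `|f (poly_curve P t)| <= (K + K) * (`|t| / s) ^+ d.
  move=> ts; have [A hA] := mdeg_lt_fset d.
  pose S := \sum_(a <- A) c a *: \prod_l Q l ^+ a l.
  pose MS := \sum_(a <- A) `|c a| *: H ^+ mdeg a.
  have SE u : S.[u] = \sum_(a <- A) c a * monomial a (hh u).
    rewrite /S horner_sum; apply: eq_bigr => a _; rewrite hornerZ horner_prod.
    by congr (_ * _); apply: eq_bigr => l _; rewrite horner_exp mxE.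
  have SM : majorized S MS.
    apply: majorized_sum => a; apply: majorizedZ; rewrite /mdeg -prodrXr.
    elim/big_rec2: _ => [|l q p _ pq]; first exact: majorized1.
    by apply: majorizedM => //; exact/majorizedX.
  have MSs : MS.[s] <= K.
    rewrite /MS horner_sum; apply: le_trans (cK A); apply: ler_sum => a _.
    rewrite hornerZ ler_wpM2l // horner_exp lerXn2r ?nnegrE ?(ltW r0) //.
    rewrite horner_coef; apply: sumr_ge0 => i _;
      rewrite mulr_ge0 ?exprn_ge0 ?(ltW s0) //.
    by rewrite /H coef_sum; apply: sumr_ge0 => l _; rewrite aQE.
  have fS u : `|u| <= s -> `|f (poly_curve P u) - S.[u]| <= K * (`|u| / s) ^+ d.
    move=> us; rewrite hhE SE.
    apply: le_trans (expansion_tail r0 cK fc hA (hhr u us)) _.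
    rewrite ler_wpM2l // lerXn2r ?nnegrE ?hhn // divr_ge0 // ltW //.
  have SX : 'X^d %| S.
    apply: bigO_dvdXn; have [C hC] := flat d; exists (C + K / s ^+ d).
    have us : \forall u \near (0 : R), `|u| < s by exact: near0_lt.
    near=> u.
    have -> : S.[u] = f (poly_curve P u) - (f (poly_curve P u) - S.[u]) by ring.
    apply: le_trans (ler_normB _ _) _; rewrite mulrDl; apply: lerD.
      by near: u.
    have us' : `|u| <= s by apply: ltW; near: u.
    by apply: le_trans (fS u us') _; rewrite exprMn exprVn; rewrite le_eqVlt;
      apply/orP; left; apply/eqP; ring.
  have -> : f (poly_curve P t) = (f (poly_curve P t) - S.[t]) + S.[t] by ring.
  apply: le_trans (ler_normD _ _) _; rewrite mulrDl; apply: lerD; first exact: fS.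
  apply: le_trans (majorized_horner SM SX s0 ts) _; rewrite mulrC ler_wpM2r //.
  by rewrite exprn_ge0 // divr_ge0 // ltW.
apply: filterS (near0_lt s0) => t ts.
apply/eqP; rewrite -normr_eq0 eq_le normr_ge0 andbT; apply/ler_addgt0Pr => e e0.
rewrite add0r.
have ts0 : 0 <= `|t| / s by rewrite divr_ge0 // ltW.
have x1 : `| `|t| / s | < 1.
  by rewrite (ger0_norm ts0) ltr_pdivrMr // mul1r.
have K1 : 0 < K + K + 1 by rewrite ltr_wpDl // addr_ge0.
have /cvgrPdist_lt/(_ (e / (K + K + 1))) := cvg_expr x1.
rewrite divr_gt0 // => /(_ isT)[M _ /(_ M (leqnn M))] /=.
rewrite sub0r normrN normrX (ger0_norm ts0) => h.
apply: le_trans (bnd M t (ltW ts)) _.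
apply: (@le_trans _ _ ((K + K) * (e / (K + K + 1)))).
  by rewrite ler_wpM2l ?addr_ge0 // ltW.
rewrite mulrA ler_pdivrMr // mulrC ler_wpM2l ?(ltW e0) //.
by rewrite lerDl.
Unshelve. all: by end_near.
Qed.

End Flat.

(** * The degree bound on minors *)
Section ContactGain.
Context {F : fieldType}.
Implicit Types (p q : {poly F}).

Lemma size_polyM_le p q a b :
  (size p <= a.+1)%N -> (size q <= b.+1)%N -> (size (p * q)%R <= (a + b).+1)%N.
Proof.
move=> pa qb; apply: leq_trans (size_polyMleq _ _) _.
by rewrite -subn1 leq_subLR add1n -addnS -addSn leq_add.
Qed.

Lemma size_prod_le (I : finType) (A : {pred I}) (f : I -> {poly F}) k :
  (forall i, size (f i) <= k.+1)%N ->
  (size (\prod_(i in A) f i)%R <= (#|A| * k).+1)%N.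
Proof.
move=> fk; rewrite -sum1_card big_distrl /=.
elim/big_rec2: _ => [|i d p _ pd]; first by rewrite size_poly1.
by rewrite mul1n; exact: size_polyM_le.
Qed.

Lemma size_sum_le (I : Type) (s : seq I) (P : pred I) (f : I -> {poly F}) d :
  (forall i, P i -> size (f i) <= d)%N -> (size (\sum_(i <- s | P i) f i)%R <= d)%N.
Proof.
move=> fd; elim/big_ind: _ => // [|p q pd qd]; first by rewrite size_poly0.
by apply: leq_trans (size_polyD _ _) _; rewrite geq_max pd.
Qed.

Lemma size_sign_mul (b : nat) p : size ((-1) ^+ b * p) = size p.
Proof. by rewrite -signr_odd mulr_sign; case: odd; rewrite // size_polyN. Qed.

Lemma size_det_le m k (A : 'M[{poly F}]_m) :
  (forall i j, size (A i j) <= k.+1)%N -> (size (\det A)%R <= (m * k).+1)%N.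
Proof.
move=> Ak; apply: size_sum_le => s _; rewrite size_sign_mul.
have := @size_prod_le _ predT (fun i => A i (s i)) k (fun i => Ak i (s i)).
by rewrite card_ord.
Qed.

Lemma size_adj_le m k (A : 'M[{poly F}]_m.+1) :
  (forall i j, size (A i j) <= k.+1)%N ->
  forall i j, (size ((\adj A) i j) <= (m * k).+1)%N.
Proof.
move=> Ak i j; rewrite mxE /cofactor size_sign_mul.
by apply: size_det_le => a b; rewrite !mxE.
Qed.

Lemma dvdXn_cancel N p q : p.[0] != 0 -> 'X^N %| p * q -> 'X^N %| q.
Proof.
move=> p0; rewrite Gauss_dvdpr //.
apply: coprimep_expl; rewrite coprimep_sym -['X]subr0 -polyC0 coprimep_XsubC /root.
exact: p0.
Qed.

Lemma dvdp_mulmx (d : {poly F}) (a b c : nat) (A : 'M[{poly F}]_(a, b))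
  (B : 'M[{poly F}]_(b, c)) :
  (forall i j, d %| A i j) -> forall i j, d %| (A *m B) i j.
Proof.
move=> dA i j; rewrite mxE; elim/big_ind: _ => [|p q|l _].
- exact: dvdp0.
- exact: dvdp_add.
- by rewrite dvdp_mulr.
Qed.

Lemma dvdp_mulmxr (d : {poly F}) (a b c : nat) (A : 'M[{poly F}]_(a, b))
  (B : 'M[{poly F}]_(b, c)) :
  (forall i j, d %| B i j) -> forall i j, d %| (A *m B) i j.
Proof.
move=> dB i j; rewrite mxE; elim/big_ind: _ => [|p q|l _].
- exact: dvdp0.
- exact: dvdp_add.
- by rewrite dvdp_mull.
Qed.

(** In the application the rows of [row_mx D1 D2] are the derivatives of the
    family of curves along [M] and [row_mx X1 X2] is its derivative in [t],
    in coordinates where the first [m] directions are tangent to [M].  The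
    matrix [col_mx G12 G22] holds the differentials of the equations of [M]
    along the curve, so that [D1 *m G12 + D2 *m G22] and
    [X1 *m G12 + X2 *m G22] measure how far these vectors are from being
    tangent to [M]. *)
Variables (m q k N : nat).
Variables (D1 : 'M[{poly F}]_m) (D2 : 'M[{poly F}]_(m, q)).
Variables (X1 : 'rV[{poly F}]_m) (X2 : 'rV[{poly F}]_q).
Variables (G12 : 'M[{poly F}]_(m, q)) (G22 : 'M[{poly F}]_q).

(** The maximal minors formed by the first [m] columns and one more column,
    expanded along the last row by Cramer's rule. *)
Let minor : 'rV[{poly F}]_q := \det D1 *: X2 - X1 *m \adj D1 *m D2.

Lemma size_minor_le : (0 < k)%N ->
  (forall i j, size (D1 i j) <= k.+1)%N -> (forall i j, size (D2 i j) <= k.+1)%N ->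
  (forall j, size (X1 0%R j) <= k)%N -> (forall j, size (X2 0%R j) <= k)%N ->
  forall j, (size (minor 0%R j) <= k * (m + 1))%N.
Proof.
case: k => // d _ D1k D2k X1k X2k j; rewrite /minor 2!mxE [X in _ + X]mxE.
have -> : (d.+1 * (m + 1) = (m * d.+1 + d).+1)%N by lia.
apply: leq_trans (size_polyD _ _) _; rewrite size_polyN geq_max; apply/andP; split.
  by apply: size_polyM_le => //; exact: size_det_le.
rewrite mxE; apply: size_sum_le => i _; rewrite mxE.
case: m D1 D2 X1 i D1k D2k X1k => [|m'] E1 E2 Y1 i E1k E2k Y1k; first by case: i.
have -> : (m'.+1 * d.+1 + d = (d + m' * d.+1) + d.+1)%N by lia.
apply: size_polyM_le => //; apply: size_sum_le => l _.
by apply: size_polyM_le => //; exact: size_adj_le.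
Qed.

(** Tangency up to order [N] makes the minors divisible by ['X^N], and the
    degree bound then forces them to vanish.  Hence
    [\det D1 *: row_mx X1 X2] is a combination of the rows of [row_mx D1 D2],
    and it inherits their order of tangency. *)
Lemma contact_gain : (0 < k)%N -> (k * (m + 1) <= N)%N ->
  (forall i j, size (D1 i j) <= k.+1)%N -> (forall i j, size (D2 i j) <= k.+1)%N ->
  (forall j, size (X1 0%R j) <= k)%N -> (forall j, size (X2 0%R j) <= k)%N ->
  (\det D1).[0] != 0 -> (\det G22).[0] != 0 ->
  (forall i j, 'X^(N.+1) %| (D1 *m G12 + D2 *m G22) i j) ->
  (forall j, 'X^N %| (X1 *m G12 + X2 *m G22) 0 j) ->
  forall j, 'X^(N.+1) %| (X1 *m G12 + X2 *m G22) 0 j.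
Proof.
move=> k0 kN D1k D2k X1k X2k D10 G0.
set ED := D1 *m G12 + _; set EX := X1 *m G12 + _ => dD dX.
have key : minor *m G22 = \det D1 *: EX - X1 *m \adj D1 *m ED.
  rewrite /minor mulmxBl /EX /ED scalerDr mulmxDr opprD addrACA.
  have -> : X1 *m \adj D1 *m (D1 *m G12) = \det D1 *: (X1 *m G12).
    by rewrite mulmxA -[X1 *m _ *m D1]mulmxA mul_adj_mx mul_mx_scalar -scalemxAl.
  by rewrite subrr add0r !mulmxA -scalemxAl.
have minor0 : minor = 0.
  have H j : 'X^N %| minor 0 j.
    apply: (dvdXn_cancel G0).
    have -> : \det G22 * minor 0 j = (minor *m G22 *m \adj G22) 0 j.
      by rewrite -mulmxA mul_mx_adj mul_mx_scalar [RHS]mxE.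
    apply: dvdp_mulmx => i l; rewrite key 2!mxE [X in _ + X]mxE ord1.
    rewrite dvdp_sub ?dvdp_mull ?dX //.
    by apply: dvdp_mulmxr => a b; apply: dvdp_trans (dD a b); rewrite dvdp_exp2l.
  apply/rowP => j; rewrite [RHS]mxE; apply/eqP/negPn/negP => nz.
  have := dvdp_leq nz (H j); rewrite size_polyXn ltnNge.
  by rewrite (leq_trans (size_minor_le k0 D1k D2k X1k X2k j) kN).
move=> j; apply: (dvdXn_cancel D10).
have -> : \det D1 * EX 0 j = (X1 *m \adj D1 *m ED) 0 j.
  have /rowP/(_ j) := key; rewrite minor0 mul0mx !mxE => /esym/eqP.
  by rewrite subr_eq0 => /eqP ->.
exact: dvdp_mulmxr.
Qed.

End ContactGain.

(** * Primitives and multiplicity of the root 0 *)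
Section Primitive.
Context {R : realType}.
Implicit Types p q : {poly R}.

Definition prim p : {poly R} :=
  \poly_(i < (size p).+1) (if i is j.+1 then p`_j / j.+1%:R else 0).

Lemma coef_prim p i : (prim p)`_i = if i is j.+1 then p`_j / j.+1%:R else 0.
Proof.
rewrite coef_poly; case: i => [|j] //; rewrite ltnS.
by case: ltnP => // h; rewrite nth_default // mul0r.
Qed.

Lemma deriv_prim p : (prim p)^`() = p.
Proof.
apply/polyP => i; rewrite coef_deriv coef_prim -[LHS]mulr_natr divfK //.
Qed.

Lemma horner0_prim p : (prim p).[0] = 0.
Proof. by rewrite horner_coef0 coef_prim. Qed.

Lemma primB p q : prim (p - q) = prim p - prim q.
Proof.
apply/polyP => i; rewrite coefB !coef_prim; case: i => [|i]; first by rewrite subrr.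
by rewrite coefB mulrBl.
Qed.

Lemma dvdXnP d p : reflect (forall i, (i < d)%N -> p`_i = 0) ('X^d %| p).
Proof.
apply: (iffP idP) => [/dvdpP[q ->] i id|H]; first by rewrite coefMXn id.
apply/dvdpP; exists (drop_poly d p).
apply/polyP => i; rewrite coefMXn coef_drop_poly.
by case: ltnP => [/H->//|di]; rewrite subnK.
Qed.

Lemma dvdXnS d p : 'X^(d.+1) %| p <-> p.[0] = 0 /\ 'X^d %| p^`().
Proof.
split=> [/dvdXnP H|[p0 /dvdXnP H]].
  split; first by rewrite horner_coef0 H.
  by apply/dvdXnP => i id; rewrite coef_deriv H ?mul0rn.
apply/dvdXnP => -[|i]; first by rewrite -horner_coef0.
rewrite ltnS => /H/eqP; rewrite coef_deriv mulrn_eq0 /=.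
by move=> /eqP.
Qed.

Lemma dvdXn_prim d p : 'X^d %| p -> 'X^(d.+1) %| prim p.
Proof. by move=> pd; apply/dvdXnS; rewrite horner0_prim deriv_prim. Qed.

Lemma dvdp_sum_all (I : Type) (s : seq I) (F : I -> {poly R}) q :
  (forall i, q %| F i) -> q %| \sum_(i <- s) F i.
Proof.
move=> H; elim/big_ind: _ => [|x y|i _]; [exact: dvdp0|exact: dvdp_add|exact: H].
Qed.

End Primitive.

(** * Taylor polynomials along polynomial curves *)
Section Taylor.
Context {R : realType} {n : nat}.
Local Notation V := 'rV[R]_n.
Implicit Types (f g : V -> R) (P : 'I_n -> {poly R}) (U : set V).

(** The Taylor polynomial in [t] of [f (poly_curve P t)], up to terms of degree
    above [J].  It is obtained by integrating the chain rule formally, each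
    integration gaining one order of accuracy. *)
Fixpoint taylor J f P : {poly R} :=
  (f (poly_curve P 0))%:P +
  if J is J'.+1 then prim (\sum_l taylor J' (partial l f) P * (P l)^`()) else 0.

Lemma taylorS J f P : taylor J.+1 f P = (f (poly_curve P 0))%:P +
  prim (\sum_l taylor J (partial l f) P * (P l)^`()).
Proof. by []. Qed.

Definition analytic_in U f := forall x, U x -> analytic_at f x.

Lemma analytic_in_partial U f l : analytic_in U f -> analytic_in U (partial l f).
Proof. by move=> fa x /fa; exact: analytic_partial. Qed.

Lemma eq_partial U f g l : open U -> (forall x, U x -> f x = g x) ->
  forall x, U x -> partial l f x = partial l g x.
Proof.
move=> oU fg x Ux; apply: near_eq_derive.
by have := open_nbhs_nbhs (conj oU Ux); apply: filterS => y /fg.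
Qed.

Lemma eq_taylor U f g P J : open U -> U (poly_curve P 0) ->
  (forall x, U x -> f x = g x) -> taylor J f P = taylor J g P.
Proof.
move=> oU UP; elim: J f g => [|J IH] f g fg; first by rewrite /= (fg _ UP).
rewrite !taylorS (fg _ UP).
have E l : taylor J (partial l f) P = taylor J (partial l g) P.
  by apply: IH => x Ux; exact: (eq_partial l oU fg Ux).
by under eq_bigr do rewrite E.
Qed.

Lemma taylor_horner0 J f P : (taylor J f P).[0] = f (poly_curve P 0).
Proof.
by case: J => [|J] /=; rewrite hornerD hornerC ?horner0_prim ?horner0 addr0.
Qed.

Lemma deriv_taylor J f P :
  (taylor J.+1 f P)^`() = \sum_l taylor J (partial l f) P * (P l)^`().
Proof. by rewrite taylorS derivD derivC add0r deriv_prim. Qed.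

Lemma taylorS_dvd J f P : 'X^(J.+1) %| taylor J.+1 f P - taylor J f P.
Proof.
elim: J f => [|J IH] f.
  by rewrite /= opprD addrACA subrr add0r subr0; apply: dvdXn_prim; rewrite expr0 dvd1p.
rewrite !taylorS opprD addrACA subrr add0r -primB -sumrB; apply: dvdXn_prim.
by apply: dvdp_sum_all => l; rewrite -mulrBl dvdp_mulr.
Qed.

Lemma is_derive_sub_horner (g : R -> R) (p : {poly R}) (t d : R) :
  is_derive (t : R) 1 g d -> is_derive (t : R) 1 (fun s => g s - p.[s]) (d - p^`().[t]).
Proof. by move=> gd; exact: (is_deriveB gd (is_derive_poly p t)). Qed.

(** The curve [gam] may be any curve whose velocity agrees with that of
    [poly_curve P] up to order [J].  Applied to a curve in [M] it reads off the
    contact hypothesis, applied to [poly_curve P] itself it computes [f] along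
    the curve. *)
Lemma taylor_bigO U f (gam : R -> V) (dgam : 'I_n -> R -> R) P J :
  open U -> analytic_in U f -> U (gam 0) -> gam 0 = poly_curve P 0 ->
  (\forall t \near (0 : R), forall l,
    is_derive (t : R) 1 (fun s => gam s 0 l) (dgam l t)) ->
  (forall l, bigO J (fun t => dgam l t - (P l)^`().[t])) ->
  bigO J.+1 (fun t => f (gam t) - (taylor J f P).[t]).
Proof.
move=> oU fa Ug g0 gd.
have Unear : \forall t \near (0 : R), U (gam t).
  have gc : {for 0, continuous gam}.
    have : derivable gam 0 1.
      apply/derivable_mxP => i j; rewrite ord1.
      by have := nbhs_singleton gd; move=> /(_ j)[].
    by move=> /derivable1_diffP/differentiable_continuous.
  exact: gc (open_nbhs_nbhs (conj oU Ug)).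
have chain h : analytic_in U h -> \forall t \near (0 : R),
    is_derive (t : R) 1 (fun s => h (gam s)) (\sum_l partial l h (gam t) * dgam l t).
  by move=> ha; apply: filterS2 Unear gd => t Ut gdt;
    exact: analytic_chain (ha _ Ut) gdt.
have bnd h : analytic_in U h -> bigO 0 (fun t => h (gam t)).
  by move=> /chain/nbhs_singleton[hd _]; exact: bigO_derivable.
elim: J f fa => [|J IH] f fa Hd.
  apply: (@bigO_integrate _ _ _ (fun t =>
    \sum_l partial l f (gam t) * dgam l t - (taylor 0 f P)^`().[t])).
  - by apply: filterS (chain f fa) => t; exact: is_derive_sub_horner.
  - by rewrite taylor_horner0 g0 subrr.
  - have : bigO 0 (fun t => \sum_l partial l f (gam t) *
        ((dgam l t - (P l)^`().[t]) + (P l)^`().[t])).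
      apply: bigO_sum => l; apply: (@bigOM _ 0 0).
        exact/bnd/analytic_in_partial.
      by apply: bigOD; [exact: Hd|exact: bigO_horner].
    apply: bigO_near; apply: near0W => t; rewrite /= addr0 derivC horner0 subr0.
    by apply: eq_bigr => l _; rewrite subrK.
apply: (@bigO_integrate _ _ _ (fun t =>
    \sum_l partial l f (gam t) * dgam l t - (taylor J.+1 f P)^`().[t])).
- by apply: filterS (chain f fa) => t; exact: is_derive_sub_horner.
- by rewrite taylor_horner0 g0 subrr.
have : bigO J.+1 (fun t => \sum_l (partial l f (gam t) * (dgam l t - (P l)^`().[t]) +
    (partial l f (gam t) - (taylor J (partial l f) P).[t]) * (P l)^`().[t])).
  apply: bigO_sum => l; apply: bigOD.
    by apply: (@bigOM _ 0 J.+1) => //; exact/bnd/analytic_in_partial.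
  rewrite -[J.+1]addn0; apply: bigOM; last exact: bigO_horner.
  apply: IH; first exact: analytic_in_partial.
  by move=> i; apply: bigO_weaken (Hd i).
apply: bigO_near; apply: near0W => t; rewrite deriv_taylor horner_sum -sumrB.
by apply: eq_bigr => l _; rewrite hornerM; ring.
Qed.

End Taylor.

(** * Varying the curve *)
Section Variation.
Context {R : realType} {n : nat}.
Local Notation V := 'rV[R]_n.
Implicit Types (f g : V -> R) (U : set V).

Lemma is_derive_sumf (I : Type) (s : seq I) (F : I -> R -> R) (dF : I -> R) (t : R) :
  (forall i, is_derive (t : R) 1 (F i) (dF i)) ->
  is_derive (t : R) 1 (fun u => \sum_(i <- s) F i u) (\sum_(i <- s) dF i).
Proof.
move=> H; elim: s => [|a s IH].
  rewrite big_nil; have -> : (fun u => \sum_(i <- [::]) F i u) =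
    cst 0 by apply/funext => u; rewrite big_nil.
  exact: is_derive_cst.
rewrite big_cons.
have -> : (fun u => \sum_(i <- a :: s) F i u) = F a + (fun u => \sum_(i <- s) F i u).
  by apply/funext => u; rewrite big_cons.
exact: is_deriveD.
Qed.

Lemma is_derive_mulf (F G : R -> R) (dF dG : R) (t : R) :
  is_derive (t : R) 1 F dF -> is_derive (t : R) 1 G dG ->
  is_derive (t : R) 1 (fun u => F u * G u) (dF * G t + F t * dG).
Proof.
move=> hF hG; apply: (is_derive_eq (is_deriveM hF hG)).
by rewrite /GRing.scale /=; ring.
Qed.

(** Derivative at 0 of a family of polynomials, coefficient by coefficient. *)
Definition coef_derive (F : R -> {poly R}) (dF : {poly R}) :=
  forall i, is_derive (0 : R) 1 (fun s => (F s)`_i) dF`_i.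

Lemma coef_deriveD F G dF dG : coef_derive F dF -> coef_derive G dG ->
  coef_derive (fun s => F s + G s) (dF + dG).
Proof.
move=> hF hG i; rewrite coefD.
have -> : (fun s => (F s + G s)`_i) = (fun s => (F s)`_i) + (fun s => (G s)`_i).
  by apply/funext => s; rewrite coefD.
exact: is_deriveD.
Qed.

Lemma coef_derive_sum (I : Type) (r : seq I) (F : I -> R -> {poly R}) dF :
  (forall i, coef_derive (F i) (dF i)) ->
  coef_derive (fun s => \sum_(i <- r) F i s) (\sum_(i <- r) dF i).
Proof.
move=> H j; rewrite coef_sum.
have -> : (fun s => (\sum_(i <- r) F i s)`_j) = (fun s => \sum_(i <- r) (F i s)`_j).
  by apply/funext => s; rewrite coef_sum.
by apply: is_derive_sumf => i; exact: H.
Qed.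

Lemma coef_deriveM F G dF dG : coef_derive F dF -> coef_derive G dG ->
  coef_derive (fun s => F s * G s) (dF * G 0 + F 0 * dG).
Proof.
move=> hF hG i; rewrite coefD !coefM -big_split /=.
have -> : (fun s => (F s * G s)`_i) =
  (fun s => \sum_(j < i.+1) (F s)`_j * (G s)`_(i - j)).
  by apply/funext => s; rewrite coefM.
by apply: is_derive_sumf => j; exact: is_derive_mulf.
Qed.

Lemma coef_derive_deriv F dF : coef_derive F dF ->
  coef_derive (fun s => (F s)^`()) dF^`().
Proof.
move=> hF i; rewrite coef_deriv.
have -> : (fun s => (F s)^`()`_i) = (i.+1%:R : R) *: (fun s => (F s)`_i.+1).
  by apply/funext => s; rewrite coef_deriv -[LHS]mulr_natl.
by rewrite -[dF`_i.+1 *+ _]mulr_natl; exact: is_deriveZ.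
Qed.

Lemma coef_derive_prim F dF : coef_derive F dF ->
  coef_derive (fun s => prim (F s)) (prim dF).
Proof.
move=> hF i; rewrite coef_prim.
have -> : (fun s => (prim (F s))`_i) =
    if i is j.+1 then (j.+1%:R^-1 : R) *: (fun s => (F s)`_j) else cst 0.
  apply/funext => s; rewrite coef_prim; case: i => // j.
  by rewrite mulrC.
case: i => [|j]; first exact: is_derive_cst.
by rewrite mulrC; exact: is_deriveZ.
Qed.

Lemma coef_deriveC (F : R -> R) (dF : R) : is_derive (0 : R) 1 F dF ->
  coef_derive (fun s => (F s)%:P) dF%:P.
Proof.
move=> hF i; rewrite coefC.
have -> : (fun s => (F s)%:P`_i) = if i == 0%N then F else cst 0.
  by apply/funext => s; rewrite coefC; case: eqP.
by case: eqP => // _; exact: is_derive_cst.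
Qed.

(** Modulo ['X^(J.+1)], the Taylor polynomial obeys the chain rule in a
    parameter of the curve: the derivatives in [t] of both sides agree because
    the second partial derivatives of [f] are symmetric. *)
Lemma taylor_variation U f (P : R -> 'I_n -> {poly R}) (dP : 'I_n -> {poly R}) J :
  open U -> analytic_in U f -> U (poly_curve (P 0) 0) ->
  (forall l, coef_derive (fun s => P s l) (dP l)) ->
  exists2 dT, coef_derive (fun s => taylor J f (P s)) dT &
    'X^(J.+1) %| dT - \sum_l taylor J (partial l f) (P 0) * dP l.
Proof.
move=> oU fa UP Pd.
have const h : analytic_in U h -> coef_derive (fun s => (h (poly_curve (P s) 0))%:P)
    (\sum_l partial l h (poly_curve (P 0) 0) * (dP l)`_0)%:P.
  move=> ha; apply: coef_deriveC;
    apply: (@analytic_chain _ _ h (fun s => poly_curve (P s) 0) 0 _ (ha _ UP)) => l.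
  have -> : (fun s => poly_curve (P s) 0 0 l) = (fun s => (P s l)`_0).
    by apply/funext => s; rewrite mxE horner_coef0.
  exact: Pd.
elim: J f fa => [|J IH] f fa.
  exists (\sum_l partial l f (poly_curve (P 0) 0) * (dP l)`_0)%:P.
    have -> : (fun s => taylor 0 f (P s)) = (fun s => (f (poly_curve (P s) 0))%:P).
      by apply/funext => s /=; rewrite addr0.
    exact: const.
  apply/dvdXnS; split; last by rewrite expr0 dvd1p.
  rewrite hornerD hornerN hornerC horner_sum -sumrB big1 // => l _.
  by rewrite hornerM taylor_horner0 horner_coef0 subrr.
have /choice[dT hdT] : forall l, exists dT,
  coef_derive (fun s => taylor J (partial l f) (P s)) dT /\
    'X^(J.+1) %| dT - \sum_k taylor J (partial k (partial l f)) (P 0) * dP k.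
  by move=> l; have [dT h1 h2] := IH _ (@analytic_in_partial _ _ U f l fa); exists dT.
exists ((\sum_l partial l f (poly_curve (P 0) 0) * (dP l)`_0)%:P +
   prim (\sum_l (dT l * (P 0 l)^`() + taylor J (partial l f) (P 0) * (dP l)^`()))).
  apply: coef_deriveD; first exact: const.
  apply: coef_derive_prim; apply: coef_derive_sum => l.
  by apply: coef_deriveM; [exact: (hdT l).1|exact: coef_derive_deriv].
apply/dvdXnS; split.
  rewrite hornerD hornerN hornerD hornerC horner0_prim addr0 horner_sum -sumrB big1 // => l _.
  by rewrite hornerM taylor_horner0 horner_coef0 subrr.
rewrite derivB derivD derivC add0r deriv_prim (big_morph _ (@derivD R) (@deriv0 R)).
have sym k l : taylor J (partial k (partial l f)) (P 0) =
  taylor J (partial l (partial k f)) (P 0).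
  by apply: (eq_taylor J oU UP) => x Ux; exact: (analytic_partialC k l (fa x Ux)).
have -> : \sum_l (dT l * (P 0 l)^`() + taylor J (partial l f) (P 0) * (dP l)^`()) -
    \sum_i (taylor J.+1 (partial i f) (P 0) * dP i)^`() =
  \sum_l ((dT l - \sum_k taylor J (partial k (partial l f)) (P 0) * dP k) * (P 0 l)^`()
   - (taylor J.+1 (partial l f) (P 0) - taylor J (partial l f) (P 0)) * (dP l)^`()).
  have -> : \sum_i (taylor J.+1 (partial i f) (P 0) * dP i)^`() =
     \sum_l ((\sum_k taylor J (partial k (partial l f)) (P 0) * dP k) * (P 0 l)^`() +
        taylor J.+1 (partial l f) (P 0) * (dP l)^`()).
    rewrite [RHS]big_split /=.
    under eq_bigr do rewrite derivM deriv_taylor.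
    rewrite big_split /=; congr (_ + _).
    under eq_bigr do rewrite mulr_suml.
    under [RHS]eq_bigr do rewrite mulr_suml.
    rewrite exchange_big /=; apply: eq_bigr => l _; apply: eq_bigr => k _.
    rewrite [LHS]mulrAC.
    exact: (congr1 (fun z => z * dP k * (P 0 l)^`()) (sym l k)).
  by rewrite -sumrB; apply: eq_bigr => l _; ring.
apply: dvdp_sum_all => l; rewrite dvdp_sub ?dvdp_mulr //; first exact: (hdT l).2.
exact: taylorS_dvd.
Qed.

End Variation.

(** * Polynomial curves *)
Section PolyCurve.
Context {R : realType} {n : nat}.
Local Notation V := 'rV[R]_n.
Implicit Types (P : 'I_n -> {poly R}) (f : V -> R) (U : set V).

Lemma is_derive_mx (g : R -> V) (t : R) : derivable g t 1 ->
  forall l, is_derive t 1 (fun s => g s 0 l) (derive1 g t 0 l).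
Proof.
move=> gd l; split; first exact: (derivable_mxP g t 1).1 gd 0 l.
by rewrite derive1E derive_mx // mxE.
Qed.

Lemma derivable_poly_curve P t : derivable (poly_curve P) t 1.
Proof.
apply/derivable_mxP => i l.
have -> : (fun x => poly_curve P x i l) = horner (P l) by apply/funext => s;
  rewrite mxE.
exact: derivable_horner.
Qed.

Lemma poly_curve_coordE P l : (fun t => poly_curve P t 0 l) = horner (P l).
Proof. by apply/funext => s; rewrite mxE. Qed.

Lemma derive1_poly_curve P : derive1 (poly_curve P) = poly_curve (fun l => (P l)^`()).
Proof.
apply/funext => t; apply/rowP => l.
have [_ <-] := is_derive_mx (@derivable_poly_curve P t) l.
by rewrite poly_curve_coordE derive_val mxE.
Qed.

Lemma derive1n_poly_curve P i :
  derive1n i (poly_curve P) = poly_curve (fun l => derivn i (P l)).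
Proof.
elim: i => [|i IH]; first by [].
rewrite derive1nS IH derive1_poly_curve; by congr poly_curve; apply/funext => l;
  rewrite derivnS.
Qed.

Lemma smooth_poly_curve P : smooth_curve (poly_curve P).
Proof. by move=> i t; rewrite derive1n_poly_curve; exact: derivable_poly_curve. Qed.

Lemma continuous_poly_curve P : continuous (poly_curve P).
Proof.
by move=> t; apply: differentiable_continuous; apply/derivable1_diffP;
  exact: derivable_poly_curve.
Qed.

Lemma taylor_poly_curve_bigO U f P J : open U -> analytic_in U f ->
  U (poly_curve P 0) ->
  bigO J.+1 (fun t => f (poly_curve P t) - (taylor J f P).[t]).
Proof.
move=> oU fa UP; apply: (taylor_bigO (U := U) (dgam := fun l t => (P l)^`().[t])) => //.
  apply: near0W => t l; rewrite poly_curve_coordE; exact: is_derive_poly.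
by move=> l; apply: (bigO_near _ (@bigO0 _ J)); apply: near0W => t; rewrite subrr.
Qed.

Lemma taylor_flat U f P : open U -> analytic_in U f -> U (poly_curve P 0) ->
  (forall d, exists2 J, (d <= J)%N & 'X^J %| taylor J f P) ->
  \forall t \near (0 : R), f (poly_curve P t) = 0.
Proof.
move=> oU fa UP TP; apply: analytic_flat => [|d]; first exact: fa.
have [J dJ TJ] := TP d; apply: bigO_weaken dJ _.
have := bigOD (bigO_weaken (leqnSn J) (taylor_poly_curve_bigO J oU fa UP)) (bigO_dvd TJ).
by apply: bigO_near; apply: near0W => t; rewrite subrK.
Qed.

(** Identity theorem along a polynomial curve: accumulating zeros force all
    Taylor polynomials to be flat. *)
Lemma analytic_zeros U f P : open U -> analytic_in U f -> U (poly_curve P 0) ->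
  (forall e : R, 0 < e -> exists t : R, [/\ t != 0, `|t| < e & f (poly_curve P t) =
    0]) ->
  \forall t \near (0 : R), f (poly_curve P t) = 0.
Proof.
move=> oU fa UP fz; apply: (taylor_flat oU) => // J; exists J => //.
have [C /nbhs_ballP[s /= s0 hs]] := taylor_poly_curve_bigO J oU fa UP.
apply: (@dvdp_trans _ 'X^(J.+1)); first by rewrite dvdp_exp2l.
apply: (@dvdXn_accum _ _ _ C) => e e0.
have [|t [t0 + ft]] := fz (Num.min s e); first by rewrite lt_min s0.
rewrite lt_min => /andP[ts te]; exists t; split => //.
have := hs t; rewrite ft sub0r normrN; apply.
by rewrite /ball /= sub0r normrN.
Qed.

(** An equation [f] of [M] vanishes along the curve in [M] provided by the
    contact, and the Taylor polynomial only depends on the jet at 0. *)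
Lemma contact_taylor U f P J (M : set V) (C : set V) x : open U ->
  analytic_in U f -> U x -> (forall y, U y -> M y -> f y = 0) ->
  contact J C M x -> poly_curve P 0 = x -> range (poly_curve P) `<=` C ->
  'X^(J.+1) %| taylor J f P.
Proof.
move=> oU fa Ux f0 cM P0 PC.
have [g [gs gM gP]] := cM _ (@smooth_poly_curve P) PC P0.
have g0 : g 0 = poly_curve P 0 by have := gP 0%N (leq0n _).
have gd i (t : R) l : is_derive t 1 (fun s => derive1n i g s 0 l) (derive1n i.+1 g t 0 l).
  exact: is_derive_mx (gs i t) l.
have Ug : \forall t \near (0 : R), U (g t).
  have gc : {for 0, continuous g}.
    by apply: differentiable_continuous; apply/derivable1_diffP; exact: gs 0%N 0.
  by apply: gc; apply: open_nbhs_nbhs; split => //; rewrite g0 P0.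
have : bigO J.+1 (fun t => f (g t) - (taylor J f P).[t]).
  apply: (taylor_bigO (U := U) (dgam := fun l t => derive1n 1 g t 0 l)) => //.
  - by rewrite g0 P0.
  - by apply: near0W => t l; exact: gd 0%N t l.
  - move=> l; pose h i t := derive1n i.+1 g t 0 l - (derivn i.+1 (P l)).[t].
    have hd i (t : R) : is_derive t 1 (h i) (h i.+1 t).
      by rewrite /h (derivnS (P l) i.+1); exact: is_derive_sub_horner.
    apply: (bigO_derivatives hd) => i iJ.
    by rewrite /h -gP // derive1n_poly_curve mxE subrr.
move=> TO; apply: bigO_dvdXn; apply: bigO_le TO.
apply: filterS Ug => t Ut; rewrite f0 //; last by apply: gM; exists t.
by rewrite sub0r normrN.
Qed.

End PolyCurve.

(** * Smooth maps along curves *)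
Section Smooth.
Context {R : realType} {n : nat}.
Local Notation V := 'rV[R]_n.

Lemma smooth_on_chain p (U : set V) (g : V -> 'rV[R]_p) (l : 'I_p) (gam : R -> V)
    (t : R) (d : 'I_n -> R) : open U -> smooth_on U g -> U (gam t) ->
  (forall i, is_derive t 1 (fun s => gam s 0 i) (d i)) ->
  derivable (fun s => g (gam s) 0 l) t 1.
Proof.
move=> oU gs Ug dg; pose f y := g y 0 l.
have fd y i : U y -> derivable f y (delta_mx 0 i : V).
  move=> Uy; have [_ H] := gs [::] y Uy.
  exact: (derivable_mxP g y _).1 (H i) 0 l.
have pE y i : U y -> partial i f y = iter_partial [:: i] g y 0 l.
  move=> Uy; have [_ H] := gs [::] y Uy.
  by rewrite /= (derive_mx (H i)) mxE.
have Unear := open_nbhs_nbhs (conj oU Ug).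
have [] : is_derive t 1 (f \o gam) (\sum_i partial i f (gam t) * d i); last by [].
apply: C1_chain => // i; first by apply: filterS Unear => y Uy; exact: fd.
have [gc _] := gs [:: i] _ Ug.
have : {for gam t, continuous (fun y => iter_partial [:: i] g y 0 l)}.
  exact: (continuous_comp gc (@coord_continuous _ _ _ 0 l _)).
move=> H; suff : partial i f y @[y --> gam t] --> partial i f (gam t) by [].
rewrite (pE _ _ Ug); apply: cvg_trans H; apply: (near_eq_cvg (F := nbhs (gam t))).
by apply: filterS Unear => y Uy; rewrite pE.
Qed.

End Smooth.

(** * Analytic continuation along polynomial curves *)
Section Continuation.
Context {R : realType} {n : nat}.
Local Notation V := 'rV[R]_n.

Lemma poly_curve_shift (P : 'I_n -> {poly R}) (t0 u : R) :
  poly_curve (fun l => P l \Po ('X + t0%:P)) u = poly_curve P (u + t0).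
Proof. by apply/rowP => l; rewrite !mxE horner_comp !hornerE. Qed.

(** The parameters near which the curve stays in [M] form a clopen set: at a
    limit of such parameters the curve is in the closed set [M], and the
    equations of [M] in a chart have zeros accumulating there. *)
Lemma poly_curve_continuation (m : nat) (M : set V) (P : 'I_n -> {poly R}) :
  analytic_submanifold m M -> closed M ->
  (\forall t \near (0 : R), M (poly_curve P t)) -> forall t, M (poly_curve P t).
Proof.
move=> [_ Mc] clM M0.
pose S := [set t : R | \forall s \near t, M (poly_curve P s)].
have SM t : S t -> M (poly_curve P t) by exact: nbhs_singleton.
have oS : open S by rewrite openE => t; exact: nbhs_interior.
suff clS : closed S.
  have /connected_intervalP cT : is_interval [set: R] by [].
  have E : S = setT.
    apply: cT; first by exists 0.
    - by exists S => //; rewrite setTI.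
    - by exists S => //; rewrite setTI.
  by move=> t; apply: SM; rewrite E.
move=> t0 clt0.
have Mt0 : M (poly_curve P t0).
  have cE : closed (poly_curve P @^-1` M).
    by apply: preimage_closed => // y _; exact: continuous_poly_curve.
  apply: cE; apply: closureS clt0; exact: SM.
have [U [W [phi [oU Up _ [psi [phia _ _ _]] Uchart]]]] := Mc _ Mt0.
pose Q l := P l \Po ('X + t0%:P).
have QP u : poly_curve Q u = poly_curve P (u + t0) by exact: poly_curve_shift.
have UQ : U (poly_curve Q 0) by rewrite QP add0r.
have Unear : \forall u \near (0 : R), U (poly_curve Q u).
  by apply: continuous_poly_curve; exact: open_nbhs_nbhs.
have key (i : 'I_n) : (m <= i)%N -> \forall u \near (0 : R),
  phi (poly_curve Q u) 0 i = 0.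
  move=> mi; apply: (@analytic_zeros _ _ U (fun y => phi y 0 i)) => //.
    by move=> y Uy; exact: phia.
  move=> e e0; have /nbhs_ballP[d /= d0 dU] := Unear.
  have m0 : 0 < Num.min d e by rewrite lt_min d0.
  have [s [Ss /= st]] := clt0 _ (nbhsx_ballx t0 _ m0).
  have : \forall s' \near s, M (poly_curve P s') /\ ball t0 (Num.min d e) s'.
    apply: filterI => //; exact: (open_nbhs_nbhs (conj (ball_open _ _) st)).
  move=> /nbhs_ballP[r /= r0 rH].
  (* s itself could be t0, which is not a zero at a nonzero distance *)
  have [s' [s's s't]] : exists s', ball s r s' /\ s' != t0.
    have r20 : 0 < r / 2 by rewrite divr_gt0.
    have r2 : r / 2 < r by rewrite ltr_pdivrMr // ltr_pMr // ltr1n.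
    have [->|st0] := eqVneq s t0; last by exists s; split => //; exact: ballxx.
    exists (t0 + r / 2); split; last by rewrite -subr_eq0 addrC addKr gt_eqF.
    by rewrite /ball /= opprD addNKr normrN gtr0_norm.
  have [Ms'] := rH _ s's.
  rewrite /ball /= distrC lt_min => /andP[s'd s'e].
  exists (s' - t0); split => //; first by rewrite subr_eq0.
  have Us' : U (poly_curve Q (s' - t0)) by apply: dU; rewrite /ball /= sub0r normrN.
  by apply: (Uchart _ Us').1 => //; rewrite QP subrK.
have : \forall u \near (0 : R), U (poly_curve Q u) /\
    forall i : 'I_n, (m <= i)%N -> phi (poly_curve Q u) 0 i = 0.
  apply: filterI => //; apply: (filter_forall (F := nbhs (0 : R))) => i.
  case: (leqP m i) => [mi|mi]; first by apply: filterS (key i mi).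
  by apply: near0W.
move=> H; have : \forall u \near (0 : R), M (poly_curve P (u + t0)).
  by apply: filterS H => u [Uu fu]; rewrite -QP; apply: (Uchart _ Uu).2.
rewrite /S /= => /nbhs_ballP[r /= r0 rH]; apply/nbhs_ballP; exists r => // s.
rewrite /ball /= => ts; have := rH (s - t0); rewrite subrK; apply.
by rewrite /ball /= sub0r normrN distrC.
Qed.

End Continuation.

(** * The order of contact increases *)
Section Local.
Context {R : realType} {m q k : nat}.
Local Notation V := 'rV[R]_(m + q).
(** A chart [phi] of [M] with inverse [psi], and the vector fields of the
    family; everything below takes place in [U `&` O]. *)
Variables (M U U' O : set V) (phi psi : V -> V) (v : 'I_k -> V -> V).
Hypotheses (oU : open U) (oU' : open U') (oO : open O).
Hypotheses (phi_an : analytic_on U phi) (psi_an : analytic_on U' psi).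
Hypothesis psiK : forall y, U' y -> U (psi y) /\ phi (psi y) = y.
Hypothesis phiK : forall x, U x -> U' (phi x) /\ psi (phi x) = x.
Hypothesis chart : forall x, U x ->
  (M x <-> forall i : 'I_(m + q), (m <= i)%N -> phi x 0 i = 0).
Hypothesis v_smooth : forall i, smooth_map (M `&` O) (v i).

Let coord (i : 'I_(m + q)) : V -> R := fun y => phi y 0 i.

Let coord_an i : analytic_in U (coord i).
Proof. by move=> x Ux; exact: phi_an. Qed.

(** The coefficient of degree [j.+1] is the vector field with index [j], which
    [insub] turns into an ordinal. *)
Definition family_poly (x : V) (l : 'I_(m + q)) : {poly R} :=
  \poly_(i < k.+1)
    (if i is j.+1 then (if insub j is Some j' then v j' x 0 l else 0) else x 0 l).

Let P := family_poly.

Lemma family_polyE x t : poly_curve (P x) t = x + \sum_(i < k) t ^+ i.+1 *: v i x.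
Proof.
apply/rowP => l; rewrite !mxE /P /family_poly horner_poly big_ord_recl expr0 mulr1.
congr (_ + _); rewrite summxE; apply: eq_bigr => i _; rewrite !mxE /= mulrC.
by rewrite add0n valK.
Qed.

Lemma family_poly0 x : poly_curve (P x) 0 = x.
Proof.
rewrite family_polyE big1 ?addr0 // => i _.
by rewrite expr0n scale0r.
Qed.

(** The coordinate curves of the chart through [x]; those with [a < m] stay in
    [M] and give the directions in which the family is differentiated. *)
Let sigma x (a : 'I_(m + q)) (s : R) : V := psi (phi x + s *: delta_mx 0 a).

Let sigma0 x a : U x -> sigma x a 0 = x.
Proof. by move=> /phiK[_ e]; rewrite /sigma scale0r addr0. Qed.

Let dsigma x a (l : 'I_(m + q)) : R := partial a (fun y => psi y 0 l) (phi x).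

Let sigma_derive x a l : U x ->
  is_derive (0 : R) 1 (fun s => sigma x a s 0 l) (dsigma x a l).
Proof.
move=> Ux; have [U'x _] := phiK Ux.
have := @is_derive_line _ _ (fun y => psi y 0 l) (phi x) a 0.
rewrite scale0r addr0; apply.
exact: nbhs_singleton (analytic_derivable a (psi_an U'x l)).
Qed.

Let sigma_continuous x a : U x -> {for 0, continuous (sigma x a)}.
Proof.
move=> Ux; apply: differentiable_continuous;
  apply/derivable1_diffP/derivable_mxP => i l.
by rewrite ord1; have [] := sigma_derive a l Ux.
Qed.

Let phi_sigma x a : U x -> \forall s \near (0 : R), U (sigma x a s) /\
  phi (sigma x a s) = phi x + s *: delta_mx 0 a.
Proof.
move=> Ux; have [U'x _] := phiK Ux.
have lc : {for (0 : R), continuous (fun s : R => phi x + s *: delta_mx 0 a : V)}.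
  by apply: continuousD; [exact: cst_continuous|exact: scalel_continuous].
have H : \forall s \near (0 : R), U' (phi x + s *: delta_mx 0 a).
  by apply: lc; rewrite scale0r addr0; exact: open_nbhs_nbhs.
by apply: filterS H => s; exact: psiK.
Qed.

(** The Jacobian matrices of the two sides of the chart are inverse, by the
    chain rule along the coordinate curves. *)
Let dpsi_dphi x : U x ->
  (\matrix_(a, l) dsigma x a l) *m (\matrix_(l, i) partial l (coord i) x) = 1%:M.
Proof.
move=> Ux; apply/matrixP => a i; rewrite !mxE.
have chn := @analytic_chain _ _ (coord i) (sigma x a) 0 (dsigma x a).
have [_ e1] : is_derive (0 : R) 1 (coord i \o sigma x a)
    (\sum_l partial l (coord i) (sigma x a 0) * dsigma x a l).
  by apply: chn => [|l]; [rewrite sigma0 //; exact: coord_an|exact: sigma_derive].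
have [_ e2] : is_derive (0 : R) 1 (coord i \o sigma x a) (a == i)%:R.
  have lin : is_derive (0 : R) 1 (fun s : R => phi x 0 i + s * (a == i)%:R) (a == i)%:R.
    apply/is_derive1P => e e0; apply: near0W => u.
    rewrite (_ : _ - _ = 0) ?normr0 ?mulr_ge0 ?(ltW e0) //; ring.
  apply: near_eq_is_derive lin; apply: filterS (phi_sigma a Ux) => s [_ /= e].
  by rewrite /coord e !mxE eqxx /= eq_sym.
rewrite -e2 e1 sigma0 //; apply: eq_bigr => l _.
by rewrite !mxE mulrC.
Qed.

Let sigma_near x (d : 'I_(m + q)) : U x -> O x -> M x -> (d < m)%N ->
  \forall s \near (0 : R), [/\ U (sigma x d s), O (sigma x d s) & M (sigma x d s)].
Proof.
move=> Ux Ox Mx dm; have H : \forall s \near (0 : R), O (sigma x d s).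
  by have sc := @sigma_continuous x d Ux; apply: sc; apply: open_nbhs_nbhs;
    rewrite sigma0.
apply: filterS2 H (phi_sigma d Ux) => s Os [Us e]; split=> //.
apply/(chart Us) => i mi; rewrite e !mxE eqxx (chart Ux).1 //.
have -> : (i == d) = false by apply/negbTE;
  rewrite -(inj_eq val_inj) gtn_eqF // (leq_trans dm).
by rewrite mulr0 addr0.
Qed.

Let coef_family_derivable x l (d : 'I_(m + q)) : U x -> O x -> M x -> (d < m)%N ->
  forall i, derivable (fun s => (P (sigma x d s) l)`_i) (0 : R) 1.
Proof.
move=> Ux Ox Mx dm i.
have -> : (fun s => (P (sigma x d s) l)`_i) = (fun s => if (i < k.+1)%N then
    if i is j.+1 then (if insub j is Some j' then v j' (sigma x d s) 0 l else 0)
    else sigma x d s 0 l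
    else 0).
  by apply/funext => s; rewrite coef_poly.
case: ltnP => _; last exact: derivable_cst.
case: i => [|j]; first by have [] := sigma_derive d l Ux.
case: insubP => [j' _ _|_]; last exact: derivable_cst.
have [|A [g [oA Ax gs gv]]] := v_smooth j' (x := x); first by [].
have As : A (sigma x d 0) by rewrite sigma0.
have := @smooth_on_chain R _ _ A g l (sigma x d) 0 (dsigma x d)
  oA gs As (fun i => sigma_derive d i Ux).
apply: near_eq_derivable.
have H : \forall s \near (0 : R), A (sigma x d s).
  by have sc := @sigma_continuous x d Ux; apply: sc; apply: open_nbhs_nbhs.
by apply: filterS2 H (sigma_near Ux Ox Mx dm) => s Hs [_ Os Ms]; rewrite gv.
Qed.

Let dfamily x (d l : 'I_(m + q)) : {poly R} :=
  \poly_(i < k.+1) 'D_1 (fun s => (P (sigma x d s) l)`_i) 0.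

Let dfamily_derive x l (d : 'I_(m + q)) : U x -> O x -> M x -> (d < m)%N ->
  coef_derive (fun s => P (sigma x d s) l) (dfamily x d l).
Proof.
move=> Ux Ox Mx dm i; rewrite coef_poly; case: ltnP => ik.
  exact/derivableP/coef_family_derivable.
have -> : (fun s => (P (sigma x d s) l)`_i) = cst 0.
  by apply/funext => s; rewrite coef_poly ltnNge ik.
exact: is_derive_cst.
Qed.

Let dfamily0 x l d : U x -> (dfamily x d l).[0] = dsigma x d l.
Proof.
move=> Ux; rewrite horner_coef0 coef_poly /=.
have -> : (fun s => (P (sigma x d s) l)`_0) = (fun s => sigma x d s 0 l).
  by apply/funext => s; rewrite coef_poly.
by have [_ ->] := sigma_derive d l Ux.
Qed.

(** If the equations of [M] vanish to order [N + 1] along all the curves, then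
    so do their derivatives in the directions of [M]; by [contact_gain] the
    derivative in [t] does as well, and integrating it gains one order. *)
Lemma family_gain N : (0 < k)%N -> (k * (m + 1) <= N)%N ->
  (forall x (i : 'I_(m + q)), M x -> U x -> O x -> (m <= i)%N ->
     'X^(N.+1) %| taylor N.+1 (coord i) (P x)) ->
  forall x (i : 'I_(m + q)), M x -> U x -> O x -> (m <= i)%N ->
     'X^(N.+2) %| taylor N.+2 (coord i) (P x).
Proof.
move=> k0 kN H x i0 Mx Ux Ox mi0.
have Px : U (poly_curve (P x) 0) by rewrite family_poly0.
pose G : 'M[{poly R}]_(m + q) := \matrix_(l, i) taylor N.+1 (partial l (coord i)) (P x).
pose D : 'M[{poly R}]_(m, m + q) := \matrix_(d, l) dfamily x (lshift q d) l.
pose X : 'rV[{poly R}]_(m + q) := \row_l (P x l)^`().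
pose S : 'M[R]_(m + q) := \matrix_(a, l) dsigma x a l.
pose C : 'M[R]_(m + q) := \matrix_(l, i) partial l (coord i) x.
have SC : S *m C = 1%:M := dpsi_dphi Ux.
pose Sp := map_mx polyC S; pose Cp := map_mx polyC C.
have CSp : Cp *m Sp = 1%:M by rewrite -map_mxM (mulmx1C SC) map_mx1.
(* the derivatives of the family along M are tangent to M up to order N + 1 *)
have DG d (i : 'I_(m + q)) : (m <= i)%N -> 'X^(N.+1) %| (D *m G) d i.
  move=> mi; have dm : (lshift q d < m)%N by rewrite /= ltn_ord.
  have Us : U (poly_curve (P (sigma x (lshift q d) 0)) 0) by rewrite sigma0.
  have [dT hT TX] := taylor_variation N.+1 oU (@coord_an i) Us
    (fun l => dfamily_derive l Ux Ox Mx dm).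
  have dT0 : 'X^(N.+1) %| dT.
    apply/dvdXnP => j jN; have [_ <-] := hT j.
    have E : \forall s \near (0 : R), cst 0 s =
      (taylor N.+1 (coord i) (P (sigma x (lshift q d) s)))`_j.
      apply: filterS (sigma_near Ux Ox Mx dm) => s [Us' Os Ms].
      by have /dvdXnP -> := H _ _ Ms Us' Os mi.
    by have [_ ->] := near_eq_is_derive E (is_derive_cst (0 : R) (0 : R) (1 : R)).
  have -> : (D *m G) d i = dT - (dT - (D *m G) d i) by rewrite opprB addrC subrK.
  rewrite dvdp_sub //; apply: dvdp_trans (dvdp_exp2l _ (leqnSn N.+1)) _.
  have -> : (D *m G) d i =
    \sum_l taylor N.+1 (partial l (coord i)) (P (sigma x (lshift q d) 0)) *
      dfamily x (lshift q d) l.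
    by rewrite sigma0 // mxE; apply: eq_bigr => l _; rewrite !mxE mulrC.
  exact: TX.
have XG (i : 'I_(m + q)) : (X *m G) 0 i = (taylor N.+2 (coord i) (P x))^`().
  by rewrite deriv_taylor mxE; apply: eq_bigr => l _; rewrite !mxE mulrC.
have T2 (i : 'I_(m + q)) : (m <= i)%N -> 'X^(N.+1) %| taylor N.+2 (coord i) (P x).
  move=> mi; rewrite -[taylor _ _ _](subrK (taylor N.+1 (coord i) (P x))).
  rewrite dvdp_add ?H //; apply: dvdp_trans (taylorS_dvd _ _ _).
  by rewrite dvdp_exp2l.
have XG0 (i : 'I_(m + q)) : (m <= i)%N -> 'X^N %| (X *m G) 0 i.
  by move=> /T2 h; rewrite XG; exact: (iffLR (dvdXnS _ _) h).2.
have fx0 : coord i0 x = 0 by exact: (chart Ux).1.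
apply/dvdXnS; rewrite taylor_horner0 family_poly0 -XG; split=> //.
(* Change of basis by the differential C of the chart at x: at t = 0 the
   directions of M become the first m coordinate vectors. *)
pose D' := D *m Cp; pose X' := X *m Cp; pose G' := Sp *m G.
have DG' : D *m G = D' *m G' by rewrite /D' /G' mulmxA -[D *m _ *m _]mulmxA CSp mulmx1.
have XG' : X *m G = X' *m G' by rewrite /X' /G' mulmxA -[X *m _ *m _]mulmxA CSp mulmx1.
have split_r (r : nat) (A : 'M[{poly R}]_(r, m + q)) (j : 'I_q) a :
   (A *m G') a (rshift m j) = (lsubmx A *m ursubmx G' + rsubmx A *m drsubmx G') a j.
  rewrite -{1}[A]hsubmxK -{1}[G']submxK mul_row_block.
  exact: row_mxEr.
have szC (p : nat) (r : nat) (A : 'M[{poly R}]_(r, m + q)) :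
    (forall a b, size (A a b) <= p)%N -> forall a b, (size ((A *m Cp) a b) <= p)%N.
  move=> Ap a b; rewrite mxE; apply: size_sum_le => l _;
    rewrite [Cp _ _]mxE mulrC mul_polyC.
  exact: leq_trans (size_scale_leq _ _) (Ap _ _).
have szD a b : (size (D' a b) <= k.+1)%N.
  by apply: szC => d l; rewrite mxE; exact: size_poly.
have szX a b : (size (X' a b) <= k)%N.
  apply: szC => d l; rewrite mxE; apply/leq_sizeP => j kj.
  by rewrite coef_deriv coef_poly ltnS ltnNge kj mul0rn.
have hD : map_mx (horner^~ 0) (lsubmx D') = 1%:M.
  apply/matrixP => a b; rewrite !mxE horner_sum.
  have /matrixP/(_ (lshift q a) (lshift q b)) := SC;
    rewrite !mxE (inj_eq (@lshift_inj _ _)) => <-.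
  by apply: eq_bigr => l _; rewrite !mxE hornerM hornerC dfamily0.
have hG : map_mx (horner^~ 0) (drsubmx G') = 1%:M.
  apply/matrixP => a b; rewrite !mxE horner_sum.
  have /matrixP/(_ (rshift m a) (rshift m b)) := SC;
    rewrite !mxE (inj_eq (@rshift_inj _ _)) => <-.
  by apply: eq_bigr => l _; rewrite !mxE hornerM hornerC taylor_horner0 family_poly0.
have det0 (p : nat) (A : 'M[{poly R}]_p) : map_mx (horner^~ 0) A = 1%:M ->
  (\det A).[0] != 0.
  move=> hA; have -> : (\det A).[0] = \det (map_mx (horner_eval 0) A).
    by rewrite det_map_mx.
  have -> : map_mx (horner_eval 0) A = 1%:M by rewrite -hA.
  by rewrite det1 oner_eq0.
case: (split_ordP i0) mi0 => [j ->|j -> _]; first by rewrite leqNgt /= ltn_ord.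
rewrite XG' split_r.
apply: (@contact_gain _ _ _ k N (lsubmx D') (rsubmx D')) => //.
- by move=> a b; rewrite mxE.
- by move=> a b; rewrite mxE.
- by move=> b; rewrite mxE.
- by move=> b; rewrite mxE.
- exact: det0.
- exact: det0.
- by move=> a b; rewrite -split_r -DG'; apply: DG; rewrite leq_addr.
- by move=> b; rewrite -split_r -XG'; apply: XG0; rewrite leq_addr.
Qed.

(** The contact hypothesis starts the induction with order [k * (m + 1) + 1]. *)
Lemma family_in_M (Gamma : V -> set V) : (0 < k)%N ->
  (forall x, M x -> O x -> Gamma x = range (fun t : R => x +
    \sum_(i < k) t ^+ i.+1 *: v i x)) ->
  (forall x, M x -> contact (k * (m + 1)) (Gamma x) M x) ->
  forall x, M x -> U x -> O x -> \forall t \near (0 : R), M (poly_curve (P x) t).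
Proof.
move=> k0 GE Gc x Mx Ux Ox.
have TX N y (i : 'I_(m + q)) : M y -> U y -> O y -> (m <= i)%N ->
    'X^((k * (m + 1) + N).+1) %| taylor (k * (m + 1) + N).+1 (coord i) (P y).
  elim: N y i => [|N IH] y i My Uy Oy mi; last first.
    by rewrite addnS; apply: family_gain => //; rewrite leq_addr.
  rewrite addn0 -[taylor _.+1 _ _](subrK (taylor (k * (m + 1)) (coord i) (P y))).
  rewrite dvdp_add ?taylorS_dvd //.
  apply: (contact_taylor oU _ Uy _ (Gc y My) (family_poly0 y)) => //.
    by move=> z Uz /(chart Uz).1; apply.
  by move=> _ [t _ <-]; rewrite (GE y My Oy); exists t => //; rewrite family_polyE.
have Unear : \forall t \near (0 : R), U (poly_curve (P x) t).
  by apply: continuous_poly_curve; apply: open_nbhs_nbhs; rewrite family_poly0.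
have key (i : 'I_(m + q)) : (m <= i)%N ->
    \forall t \near (0 : R), phi (poly_curve (P x) t) 0 i = 0.
  move=> mi; apply: (@taylor_flat _ _ U (coord i)) => //; first by rewrite family_poly0.
  move=> d; exists ((k * (m + 1) + d).+1); first by rewrite leqW // leq_addl.
  exact: TX.
have : \forall t \near (0 : R), U (poly_curve (P x) t) /\
    forall i : 'I_(m + q), (m <= i)%N -> phi (poly_curve (P x) t) 0 i = 0.
  apply: filterI => //; apply: (filter_forall (F := nbhs (0 : R))) => i.
  case: (leqP m i) => [mi|mi]; first by apply: filterS (key i mi).
  by apply: near0W.
by apply: filterS => t [Ut ft]; apply/(chart Ut).
Qed.

End Local.

(** * Curves of high contact are contained in the submanifold *)
Theorem theorem1p3 (R : realType) (n m k : nat) (M : set 'rV[R]_n)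
    (Gamma : 'rV[R]_n -> set 'rV[R]_n)
    (k_ge1 : (1 <= k)%N)
    (M_submanifold : analytic_submanifold m M)
    (M_proper : closed M)
    (Gamma_family : smooth_family k M Gamma)
    (Gamma_contact : forall x, M x -> contact (k * (m + 1)) (Gamma x) M x) :
  forall x, M x -> Gamma x `<=` M.
Proof.
move=> x Mx; have [mn Mchart] := M_submanifold.
have [q nE] : exists q, n = (m + q)%N by exists (n - m)%N; rewrite subnKC.
subst n.
have [U [U' [phi [oU Ux oU' [psi [phi_an psi_an phiK psiK]] chart]]]] := Mchart x Mx.
have [W [v [oW Wx v_smooth GammaE]]] := Gamma_family.2 x Mx.
have GammaE' y : M y -> W y -> Gamma y = range (fun t : R => y +
  \sum_(i < k) t ^+ i.+1 *: v i y).
  by move=> My Wy; apply: GammaE.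
have near_M := family_in_M oU oU' oW phi_an psi_an psiK phiK chart v_smooth k_ge1
  GammaE' Gamma_contact Mx Ux Wx.
rewrite GammaE' // => _ [t _ <-].
rewrite -family_polyE; exact: poly_curve_continuation M_submanifold M_proper near_M t.
Qed.
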